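(* Let $d\ge 2$, let $f\in\mathscr{O}_C'(\mathbb{R}^d)$, let $V\subset\mathbb{R}^d$ be any nonempty open set and let $0<\alpha<d$ be such that $(\alpha-d)/2\notin\mathbb{Z}$. If $f|_V=0$ and $I_\alpha f|_V=0$, then $f=0$.
   Context: $\mathscr{S}'(\mathbb{R}^d)$ is the space of tempered distributions. $\mathscr{O}_M(\mathbb{R}^d)$ is the space of polynomially increasing smooth functions (smooth functions all of whose derivatives are polynomially bounded). $\mathscr{O}_C'(\mathbb{R}^d)\subset\mathscr{S}'(\mathbb{R}^d)$ is the space of rapidly decreasing distributions: those $f$ such that for every $k\in\mathbb{N}$ one can write $f$ as a finite sum $\sum_\beta\partial^\beta g_\beta$ with $g_\beta$ continuous and $(1+|x|^2)^{k/2}g_\beta$ bounded; equivalently, those tempered distributions whose Fourier transform lies in $\mathscr{O}_M(\mathbb{R}^d)$. Convolution is a separately continuous map $*:\mathscr{O}_C'(\mathbb{R}^d)\times\mathscr{S}'(\mathbb{R}^d)\to\mathscr{S}'(\mathbb{R}^d)$, characterized (up to Fourier normalization constants) by $\widehat{f*g}=\widehat f\cdot\widehat g$. For $\alpha<d$ the function $|x|^{-\alpha}$ is locally integrable and defines a tempered distribution, and the Riesz potential of $f\in\mathscr{O}_C'(\mathbb{R}^d)$ is $I_\alpha f=f*|\cdot|^{-\alpha}\in\mathscr{S}'(\mathbb{R}^d)$. *)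

(* Defs.v *)
From HB Require Import structures.
From mathcomp Require Import all_boot all_order all_algebra.
From mathcomp Require Import all_classical all_reals all_analysis.
From mathcomp Require Import complex.

Set Implicit Arguments.
Unset Strict Implicit.
Unset Printing Implicit Defensive.

Import Order.TTheory GRing.Theory Num.Theory.
Import numFieldNormedType.Exports.

Local Open Scope classical_set_scope.
Local Open Scope ring_scope.

(* Lebesgue measure on R^d, carried by d-tuples because these already have the
   product sigma-algebra (of the Borel sets of R) in the library. *)
Section lebesgue_Rn.
Variable R : realType.
Local Notation Rn d := (d.-tuple (measurableTypeR R)).

Definition tcons d (p : measurableTypeR R * Rn d) : Rn d.+1 :=
  [tuple of p.1 :: p.2].

Lemma measurable_tcons d : measurable_fun [set: _] (@tcons d).
Proof. by apply: measurable_cons; [exact: measurable_fst|exact: measurable_snd]. Qed.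

Section step.
Variables (d : nat) (m : {sigma_finite_measure set (Rn d) -> \bar R}).

Definition lebesgue_step : set (Rn d.+1) -> \bar R :=
  pushforward (lebesgue_measure \x m)%E (@tcons d).

Let mtcons_preimage (A : set (Rn d.+1)) :
  measurable A -> measurable (@tcons d @^-1` A).
Proof. by move=> mA; rewrite -[X in measurable X]setTI; exact: measurable_tcons. Qed.

Let lebesgue_step0 : lebesgue_step set0 = 0%E.
Proof. by rewrite /lebesgue_step /pushforward preimage_set0 measure0. Qed.

Let lebesgue_step_ge0 A : (0 <= lebesgue_step A)%E.
Proof. exact: (measure_ge0 (lebesgue_measure \x m)%E). Qed.

Let lebesgue_step_sigma_additive : semi_sigma_additive lebesgue_step.
Proof.
move=> F mF tF mUF; rewrite /lebesgue_step /pushforward preimage_bigcup.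
apply: measure_semi_sigma_additive.
- by move=> n; exact: mtcons_preimage.
- apply/trivIsetP => /= i j _ _ ij; rewrite -preimage_setI.
  by move/trivIsetP : tF => /(_ _ _ _ _ ij) ->//; rewrite preimage_set0.
- by rewrite -preimage_bigcup; exact: mtcons_preimage.
Qed.

HB.instance Definition _ := isMeasure.Build _ _ _ lebesgue_step
  lebesgue_step0 lebesgue_step_ge0 lebesgue_step_sigma_additive.

Let lebesgue_step_sigma_finite : sigma_finite setT lebesgue_step.
Proof.
have /sigma_finiteP[F [TF ndF Foo]] := sigma_finiteT (@lebesgue_measure R).
have /sigma_finiteP[G [TG ndG Goo]] := sigma_finiteT m.
pose u (t : Rn d.+1) : measurableTypeR R * Rn d :=
  (thead t, [tuple of behead t]).
have mu : measurable_fun [set: _] u.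
  apply: measurable_fun_pair; last exact: measurable_behead.
  exact: measurable_tnth.
have tconsK p : u (tcons p) = p.
  by case: p => x t; congr pair; rewrite ?theadE//; exact: val_inj.
exists (fun n => u @^-1` (F n `*` G n)).
  rewrite -preimage_bigcup (_ : \bigcup_i _ = setT)// -subTset => -[x t] _.
  have [i _ Fix] : (\bigcup_i F i) x by rewrite -TF.
  have [j _ Gjt] : (\bigcup_j G j) t by rewrite -TG.
  exists (maxn i j) => //; split.
  - by move: x Fix; exact/subsetPset/ndF/leq_maxl.
  - by move: t Gjt; exact/subsetPset/ndG/leq_maxr.
move=> n; have [mF Ffin] := Foo n; have [mG Gfin] := Goo n; split.
  by rewrite -[X in measurable X]setTI; apply: mu => //; exact: measurableX.
rewrite /lebesgue_step /pushforward (_ : _ @^-1` _ = F n `*` G n).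
  by rewrite product_measure1E// lte_mul_pinfty// ge0_fin_numE.
by apply/funext => p; rewrite /preimage /mkset tconsK.
Qed.

HB.instance Definition _ := Measure_isSigmaFinite.Build _ _ _ lebesgue_step
  lebesgue_step_sigma_finite.
End step.

Fixpoint lebesgue_Rn d : {sigma_finite_measure set (Rn d) -> \bar R} :=
  match d with
  | 0 => \d_([tuple] : Rn 0)
  | d'.+1 => lebesgue_step (lebesgue_Rn d')
  end.
End lebesgue_Rn.

Section distributions.
Variables (R : realType) (d : nat).
Local Notation Rd := 'rV[R]_d.
Local Notation C := R[i].
Local Notation mu := (@lebesgue_Rn R d).

Definition integral_Rd (f : Rd -> C) : C :=
  Complex (Rintegral mu setT (fun t => complex.Re (f (\row_i tnth t i))))
          (Rintegral mu setT (fun t => complex.Im (f (\row_i tnth t i)))).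

(* The library norm on 'rV[R]_d is the sup norm. *)
Definition enorm (x : Rd) : R := Num.sqrt (\sum_i x 0 i ^+ 2).

Definition jbracket (x : Rd) : R := Num.sqrt (1 + enorm x ^+ 2).

Definition cabs (z : C) : R := ComplexField.Normc.normc z.

Definition ccontinuous (f : Rd -> C) : Prop :=
  continuous (fun x => complex.Re (f x)) /\
  continuous (fun x => complex.Im (f x)).

Definition partial (i : 'I_d) (f : Rd -> C) : Rd -> C := fun x =>
  Complex ('D_(delta_mx 0 i) (fun y => complex.Re (f y)) x)
          ('D_(delta_mx 0 i) (fun y => complex.Im (f y)) x).

(* A multi-index is a list of coordinates, of order the size of the list;
   on smooth functions the order of the coordinates is irrelevant. *)
Definition Dpart (s : seq 'I_d) (f : Rd -> C) : Rd -> C := foldr partial f s.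

Definition smooth (f : Rd -> C) : Prop := forall (s : seq 'I_d) (x : Rd),
  differentiable (fun y => complex.Re (Dpart s f y)) x /\
  differentiable (fun y => complex.Im (Dpart s f y)) x.

Definition schwartz (phi : Rd -> C) : Prop :=
  smooth phi /\
  forall (k : nat) (s : seq 'I_d), exists M : R, forall x : Rd,
    jbracket x ^+ k * cabs (Dpart s phi x) <= M.

(* An increasing family of seminorms that generates the topology of S(R^d). *)
Definition schwartz_seminorm (N : nat) (phi : Rd -> C) : R :=
  sup [set r | exists (s : seq 'I_d) (x : Rd),
    (size s <= N)%N /\ r = jbracket x ^+ N * cabs (Dpart s phi x)].

(* Distributions are functionals on all functions, of which only the values at
   Schwartz functions are ever constrained or used. *)
Definition functional := (Rd -> C) -> C.

Definition tempered (T : functional) : Prop :=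
  (forall (a : C) (phi psi : Rd -> C), schwartz phi -> schwartz psi ->
     T (fun x => a * phi x + psi x) = a * T phi + T psi) /\
  exists (N : nat) (M : R), forall phi, schwartz phi ->
    cabs (T phi) <= M * schwartz_seminorm N phi.

Definition of_fun (g : Rd -> C) : functional :=
  fun phi => integral_Rd (fun x => g x * phi x).

Definition distr_deriv (s : seq 'I_d) (T : functional) : functional :=
  fun phi => (-1) ^+ size s * T (Dpart s phi).

Definition distr_eq (S T : functional) : Prop :=
  forall phi, schwartz phi -> S phi = T phi.

Definition distr0 : functional := fun=> 0.

(* T vanishes on V. *)
Definition vanishes_on (V : set Rd) (T : functional) : Prop :=
  forall phi : Rd -> C, smooth phi ->
    compact (closure [set x | phi x != 0]) ->
    closure [set x | phi x != 0] `<=` V -> T phi = 0.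

(* The space O_C' of rapidly decreasing distributions. *)
Definition rapidly_decreasing (f : functional) : Prop :=
  tempered f /\
  forall k : nat, exists (n : nat) (b : 'I_n -> seq 'I_d) (g : 'I_n -> Rd -> C),
    (forall j, ccontinuous (g j) /\
       exists M : R, forall x, jbracket x ^+ k * cabs (g j x) <= M) /\
    distr_eq f (fun phi => \sum_j distr_deriv (b j) (of_fun (g j)) phi).

(* <f * g, phi> = <g, f^v * phi>, where f^v is the reflection of f and
   (f^v * phi)(x) = <f, phi (x + .)>, which is a Schwartz function of x for
   f in O_C' and phi in S. *)
Definition conv (f g : functional) : functional :=
  fun phi => g (fun x => f (fun y => phi (x + y))).

Definition riesz_potential (alpha : R) (f : functional) : functional :=
  conv f (of_fun (fun x => (enorm x `^ (- alpha))%:C%C)).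

End distributions.

(* Main.v *)
(* For a test function phi supported close to a point x0 of V, translated to
   the origin, put F(x) = <f, phi(x + .)>.  Since f is rapidly decreasing, F is
   continuous and decays; since f vanishes on V, F vanishes near 0; and since
   the Riesz potential vanishes on V, the integral of |x - a|^-alpha F(x)
   vanishes for all small a.  Differentiating in a, F is orthogonal to all
   derivatives of |x|^-alpha.  The Laplacian sends |x|^-g to a multiple of
   |x|^-(g+2), which is nonzero for g = alpha, alpha + 2, ... because
   (alpha - d)/2 is not an integer.  Hence F is orthogonal to
   <v,x>^j |x|^(-alpha-2m) for all v and all m >= j, that is, to |x|^-alpha times
   polynomials in the Kelvin transform x/|x|^2, among which there are sequences
   of positive kernels that concentrate at any prescribed point; so F = 0.
   Thus f kills every Schwartz function with small support, and confining one
   coordinate at a time by smooth cutoffs, it kills all of them. *)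
From HB Require Import structures.
Require Import Defs.
From mathcomp Require Import all_boot all_order all_algebra.
From mathcomp Require Import all_classical all_reals all_analysis.
From mathcomp Require Import measurable_realfun complex ring lra.
Set Implicit Arguments.
Unset Strict Implicit.
Unset Printing Implicit Defensive.
Import Order.TTheory GRing.Theory Num.Theory.
Import numFieldNormedType.Exports.
Local Open Scope classical_set_scope.
Local Open Scope ring_scope.

(** * Integration on R^d *)

(** The pole of the kernels is never met: F vanishes on a ball of radius 2 rho and a stays below
    rho, so however singular |x|^(-alpha-2m) becomes, only its values at distance at least rho from
    the origin count. At infinity only the integrability of F is used, so kernels must be bounded
    there; the condition m >= j guarantees it. In the variable z = x/|x|^2 the exterior of a ball
    becomes a bounded set, and the available kernels become polynomials in z. Instead of a density
    theorem, an explicit power q^n is tested against F: if F were positive at y0, the mass near y0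
    would shrink at a strictly slower geometric rate than the mass elsewhere, although the two must
    balance. This is an argument about signs, so it is run on the real and imaginary parts of F,
    which is possible because the Riesz kernel is real. F vanishing on all of R^d means that f kills
    test functions of small support located anywhere, not only near V. A general Schwartz function
    is not a finite sum of such functions; the passage to it avoids infinite partitions of unity by
    sliding a one-variable step. *)

Lemma lebesgue_measure_shift (R : realType) (a : R) (A : set (measurableTypeR R)) :
  measurable A -> lebesgue_measure ((fun x => x + a) @^-1` A) = lebesgue_measure A.
Proof.
move=> mA; pose s : measurableTypeR R -> measurableTypeR R := fun x => x + a.
have mS : measurable_fun setT s by exact: measurable_funD.
pose m : {measure set (measurableTypeR R) -> \bar R} :=
  measure_function_pushforward__canonical__measure_function_Measure
    lebesgue_measure mS.
rewrite -[LHS]/(m A); apply/esym/lebesgue_measure_unique => //.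
move=> X /= [[p q] _ <-] /=.
rewrite /m /= /pushforward (_ : _ @^-1` _ = `]p - a, q - a]%classic); last first.
  by apply/seteqP; split=> x /=; rewrite /s !in_itv/= ltrBlDr lerBrDr.
rewrite !lebesgue_measure_itv/= !lte_fin ltrD2r; case: ifPn => // _.
by congr EFin; ring.
Qed.

Lemma ge0_integral_shift (R : realType) (a : R) (f : measurableTypeR R -> \bar R) :
  measurable_fun setT f -> (forall x, 0 <= f x)%E ->
  (\int[lebesgue_measure]_x f (x + a)%R = \int[lebesgue_measure]_x f x)%E.
Proof.
move=> mf f0; pose s : measurableTypeR R -> measurableTypeR R := fun x => x + a.
have mS : measurable_fun setT s by exact: measurable_funD.
have := @ge0_integral_pushforward _ _ _ _ _ s mS lebesgue_measure setT f measurableT.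
rewrite preimage_setT => H; rewrite -[LHS]H ?measurable_funTS//.
apply: eq_measure_integral => A mA _; exact: lebesgue_measure_shift.
Qed.

Section Rn.
Variable R : realType.
Local Notation Rn d := (d.-tuple (measurableTypeR R)).

Lemma ge0_integral_RnS d (f : Rn d.+1 -> \bar R) :
  measurable_fun setT f -> (forall x, 0 <= f x)%E ->
  (\int[lebesgue_Rn R d.+1]_x f x =
   \int[lebesgue_measure]_x \int[lebesgue_Rn R d]_t f (tcons (x, t)))%E.
Proof.
move=> mf f0.
have -> : (\int[lebesgue_Rn R d.+1]_x f x =
  \int[lebesgue_measure \x lebesgue_Rn R d]_x (f \o @tcons R d) x)%E.
  have := @ge0_integral_pushforward _ _ _ _ _ (@tcons R d) (@measurable_tcons R d)
    (lebesgue_measure \x lebesgue_Rn R d)%E setT f measurableT.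
  by rewrite preimage_setT => H; rewrite -H// measurable_funTS.
rewrite fubini_tonelli1 => [//||x]; last exact: f0.
by apply: measurableT_comp => //; exact: measurable_tcons.
Qed.

Definition tshift d (a t : Rn d) : Rn d := [tuple tnth t i + tnth a i | i < d].

Lemma measurable_tshift d (a : Rn d) : measurable_fun setT (tshift a).
Proof.
apply/measurable_fun_tnthP => i.
rewrite (_ : _ \o _ = fun t => tnth t i + tnth a i); last first.
  by apply/funext => t /=; rewrite tnth_mktuple.
by apply: measurable_funD => //; exact: measurable_tnth.
Qed.

Lemma tshift_tcons d (a : Rn d.+1) x (t : Rn d) :
  tshift a (tcons (x, t)) = tcons (x + thead a, tshift [tuple of behead a] t).
Proof.
apply: eq_from_tnth => i; rewrite tnth_mktuple.
case: (unliftP ord0 i) => [j ->|->]; last by rewrite !tnth0.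
by rewrite !tnthS tnth_mktuple [in LHS](tuple_eta a) tnthS.
Qed.

Lemma measurable_fun_tcons d (f : Rn d.+1 -> \bar R) x :
  measurable_fun setT f -> measurable_fun setT (fun t => f (tcons (x, t))).
Proof.
move=> mf; apply: (measurableT_comp mf).
apply: (measurableT_comp (@measurable_tcons R d)).
exact: measurable_fun_pair.
Qed.

(** The measure is built by recursion on the dimension, so translation invariance is inherited one
    coordinate at a time through Tonelli. *)
Lemma ge0_integral_tshift d (a : Rn d) (f : Rn d -> \bar R) :
  measurable_fun setT f -> (forall x, 0 <= f x)%E ->
  (\int[lebesgue_Rn R d]_t f (tshift a t) = \int[lebesgue_Rn R d]_t f t)%E.
Proof.
elim: d a f => [|d IH] a f mf f0.
  by apply: eq_integral => t _; rewrite (tuple0 t) (tuple0 (tshift _ _)).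
rewrite !ge0_integral_RnS//; last first.
  by apply: measurableT_comp => //; exact: measurable_tshift.
under eq_integral => x _.
  under eq_integral => t _ do rewrite tshift_tcons.
  rewrite (IH _ (fun t => f (tcons (x + thead a, t))))//; last exact: measurable_fun_tcons.
  over.
apply: (@ge0_integral_shift _ _ (fun x => \int[lebesgue_Rn R d]_t f (tcons (x, t)))%E).
  pose g := fun p => f (@tcons R d p).
  apply: (@measurable_fun_fubini_tonelli_F _ _ _ _ _ _ g) => //.
  by apply: measurableT_comp => //; exact: measurable_tcons.
  by move=> x; exact: f0.
by move=> x; apply: integral_ge0 => t _; exact: f0.
Qed.

(** Row vectors carry the norm and the derivatives, tuples carry the measure. The real and imaginary
    parts of [integral_Rd] are [rint]s by conversion. *)
Definition rint d (g : 'rV[R]_d -> R) : R :=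
  Rintegral (lebesgue_Rn R d) setT (fun t => g (\row_i tnth t i)).
Definition rmeas d (g : 'rV[R]_d -> R) :=
  measurable_fun [set: Rn d] (fun t => g (\row_i tnth t i)).
Definition rintegrable d (g : 'rV[R]_d -> R) :=
  (lebesgue_Rn R d).-integrable setT (fun t => (g (\row_i tnth t i))%:E).

Lemma row_tshift d (a : 'rV[R]_d) (t : Rn d) :
  \row_i tnth (tshift [tuple a 0 i | i < d] t) i = (\row_i tnth t i) + a.
Proof. by apply/rowP => i; rewrite !mxE !tnth_mktuple. Qed.

Lemma rint_shift d (a : 'rV[R]_d) (g : 'rV[R]_d -> R) :
  rmeas g -> rint (fun x => g (x + a)) = rint g.
Proof.
move=> mg; rewrite /rint /Rintegral; congr fine.
under eq_integral do rewrite -row_tshift.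
have mE : measurable_fun [set: Rn d] (fun t => (g (\row_i tnth t i))%:E).
  exact/measurable_EFinP.
rewrite [LHS]integralE [RHS]integralE; congr (_ - _)%E.
  have := ge0_integral_tshift [tuple a 0 i | i < d] (measurable_funepos mE) (funepos_ge0 _).
  by move=> <-; apply: eq_integral => t _; rewrite !funeposE.
have := ge0_integral_tshift [tuple a 0 i | i < d] (measurable_funeneg mE) (funeneg_ge0 _).
by move=> <-; apply: eq_integral => t _; rewrite !funenegE.
Qed.

Lemma row_norm_le d (x : 'rV[R]_d) (e : R) : 0 <= e ->
  (forall i, `|x 0 i| <= e) -> `|x| <= e.
Proof.
move=> e0 H; rewrite -[`|x|]/(mx_norm x) mx_normrE; apply/bigmax_leP; split => //= -[i j] _ /=.
by rewrite ord1.
Qed.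

Lemma row_norm_ge d (x : 'rV[R]_d) i : `|x 0 i| <= `|x|.
Proof.
rewrite -[`|x|]/(mx_norm x) mx_normrE.
by apply: (le_bigmax _ (fun ij => `|x ij.1 ij.2|) (0, i)).
Qed.

(* g is the pointwise limit of its compositions with the roundings to the grids
   (n+1)^-1 Z^d, which take countably many values. *)
Lemma continuous_rmeas d (g : 'rV[R]_d -> R) : continuous g -> rmeas g.
Proof.
move=> cg.
pose D (n : nat) (t : Rn d) : 'rV[R]_d :=
  \row_i ((Num.floor (tnth t i * n.+1%:R))%:~R / n.+1%:R).
apply: (@measurable_fun_cvg _ _ _ _ (fun n t => g (D n t))) => //; last first.
  move=> t _; apply: (@cvg_comp _ _ _ (fun n => D n t) g _ (nbhs (\row_i tnth t i))); last exact: cg.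
  apply/cvgrPdist_le => e e0.
  near=> n; apply: row_norm_le; first exact: ltW.
  move=> i; rewrite !mxE.
  have /andP[] := floor_itv (tnth t i * n.+1%:R).
  set z := Num.floor _ => h1 h2.
  have n0 : (0 : R) < n.+1%:R by [].
  rewrite ger0_norm; last by rewrite subr_ge0 ler_pdivrMr.
  apply: (@le_trans _ _ n.+1%:R^-1).
    rewrite lerBlDr -[X in X + _]mul1r -mulrDl ler_pdivlMr// addrC.
    by rewrite intrD in h2; exact: ltW.
  by apply: ltW; near: n; exact: (near_infty_natSinv_lt (PosNum e0)).
move=> n _ Y mY; rewrite setTI.
pose F (k : 'rV[int]_d) := [set t : Rn d | Y (g (map_mx (fun z => z%:~R / n.+1%:R) k)) /\
   forall i, Num.floor (tnth t i * n.+1%:R) = k 0 i].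
rewrite (_ : _ @^-1` _ = \bigcup_k F k); last first.
  apply/seteqP; split=> [t Yt|t [k _ [Yk tk]]] /=.
    exists (\row_i Num.floor (tnth t i * n.+1%:R)) => //; split.
      by rewrite (_ : map_mx _ _ = D n t)//; apply/rowP => i; rewrite !mxE.
    by move=> i; rewrite mxE.
  by rewrite (_ : D n t = map_mx (fun z => z%:~R / n.+1%:R) k)//; apply/rowP => i; rewrite !mxE tk.
apply: countable_bigcupT_measurable; first exact: countableP.
move=> k; have [Yk|Yk] := pselect (Y (g (map_mx (fun z => z%:~R / n.+1%:R) k))); last first.
  by rewrite (_ : F k = set0)//; apply/seteqP; split=> // t [].
rewrite (_ : F k = \bigcap_(i in [set: 'I_d])
    ((@tnth d _ ^~ i) @^-1` `[(k 0 i)%:~R / n.+1%:R, (k 0 i + 1)%:~R / n.+1%:R[%classic)).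
  apply: fin_bigcap_measurable; first exact: finite_finset.
  move=> i _; rewrite -[X in measurable X]setTI.
  by apply: measurable_tnth => //; exact: measurable_itv.
apply/seteqP; split=> [t [_ tk] i _|t tk] /=.
  rewrite in_itv/= ler_pdivrMr// ltr_pdivlMr//.
  by have := floor_itv (tnth t i * n.+1%:R); rewrite tk.
split => // i; apply: floor_def; have := tk i I.
by rewrite /= in_itv/= ler_pdivrMr// ltr_pdivlMr.
Unshelve. all: end_near. Qed.

Lemma integral_oneDsqrV_lty :
  (\int[@lebesgue_measure R]_x ((oneDsqr x)^-1)%:E < +oo)%E.
Proof.
rewrite (@ge0_symfun_integralT R (fun x : R => (oneDsqr x)^-1)).
- rewrite (_ : [set x : R | 0 <= x] = `[0, +oo[%classic) ?integral0y_oneDsqr -?EFinM ?ltry//; last first.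
    by apply/seteqP; split => x /=; rewrite in_itv/= andbT.
- by move=> x; rewrite invr_ge0 (le_trans _ (oneDsqr_ge1 x)).
- exact: continuous_oneDsqrV.
- by move=> x /=; rewrite /oneDsqr sqrrN.
Qed.

(** The integrable majorant of the whole development. Its product form makes the integral over R^d
    factor into the one-dimensional integrals of 1/(1+x^2). *)
Definition oneDsqrs d (x : 'rV[R]_d) : R := \prod_(i < d) (oneDsqr (x 0 i))^-1.

Lemma measurable_oneDsqrV : measurable_fun [set: R] (fun x : R => (oneDsqr x)^-1).
Proof. by apply: continuous_measurable_fun; exact: continuous_oneDsqrV. Qed.

Lemma rmeas_coord d (i : 'I_d) : rmeas (fun x : 'rV[R]_d => x 0 i).
Proof. by rewrite /rmeas; under eq_fun do rewrite mxE; exact: measurable_tnth. Qed.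

Lemma rmeas_prod d (I : Type) (s : seq I) (f : I -> 'rV[R]_d -> R) :
  (forall i, rmeas (f i)) -> rmeas (fun x => \prod_(i <- s) f i x).
Proof.
move=> mf; rewrite /rmeas; elim: s => [|i s IH].
  under eq_fun do rewrite big_nil.
  exact: measurable_cst.
under eq_fun do rewrite big_cons.
by apply: measurable_funM; [exact: mf|exact: IH].
Qed.

Lemma rmeas_sum d (I : Type) (s : seq I) (f : I -> 'rV[R]_d -> R) :
  (forall i, rmeas (f i)) -> rmeas (fun x => \sum_(i <- s) f i x).
Proof.
move=> mf; rewrite /rmeas; elim: s => [|i s IH].
  under eq_fun do rewrite big_nil.
  exact: measurable_cst.
under eq_fun do rewrite big_cons.
by apply: measurable_funD; [exact: mf|exact: IH].
Qed.

Lemma rmeas_oneDsqrs d : rmeas (@oneDsqrs d).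
Proof.
apply: rmeas_prod => i.
apply: (@measurableT_comp _ _ _ _ _ _ (fun x : R => (oneDsqr x)^-1)).
  exact: measurable_oneDsqrV.
exact: rmeas_coord.
Qed.

Lemma oneDsqrs_ge0 d (x : 'rV[R]_d) : 0 <= oneDsqrs x.
Proof. by apply: prodr_ge0 => i _; rewrite invr_ge0 (le_trans _ (oneDsqr_ge1 _)). Qed.

Lemma rintegrable_oneDsqrs d : rintegrable (@oneDsqrs d).
Proof.
apply/integrableP; split; first by apply/measurable_EFinP; exact: rmeas_oneDsqrs.
under eq_integral do rewrite gee0_abs ?lee_fin ?oneDsqrs_ge0//.
elim: d => [|d IH].
  rewrite (eq_integral (cst 1%E)); last by move=> t _; rewrite /oneDsqrs big_ord0.
  by rewrite integral_cst//= mul1e diracE ltry.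
rewrite ge0_integral_RnS; last 2 first.
- by apply/measurable_EFinP; exact: rmeas_oneDsqrs.
- by move=> x; rewrite lee_fin oneDsqrs_ge0.
have E x t : oneDsqrs (\row_i tnth (@tcons R d (x, t)) i) =
    (oneDsqr x)^-1 * oneDsqrs (\row_i tnth t i).
  rewrite /oneDsqrs big_ord_recl mxE tnth0; congr (_ * _).
  by apply: eq_bigr => i _; rewrite !mxE tnthS.
under eq_integral => x _.
  under eq_integral => t _ do rewrite E EFinM.
  rewrite ge0_integralZl//.
  - over.
  - by apply/measurable_EFinP; exact: rmeas_oneDsqrs.
  - by move=> t _; rewrite lee_fin oneDsqrs_ge0.
rewrite ge0_integralZr//.
- rewrite lte_mul_pinfty//.
  + by apply: integral_ge0 => x _; rewrite lee_fin invr_ge0 (le_trans _ (oneDsqr_ge1 _)).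
  + rewrite ge0_fin_numE ?integral_oneDsqrV_lty//.
    by apply: integral_ge0 => x _; rewrite lee_fin invr_ge0 (le_trans _ (oneDsqr_ge1 _)).
- by apply/measurable_EFinP; exact: measurable_oneDsqrV.
- by apply: integral_ge0 => t _; rewrite lee_fin oneDsqrs_ge0.
Qed.

(** Serves to give a small box around a point positive finite mass. *)
Lemma measure_box d (c : 'I_d -> R) (r : R) : 0 < r ->
  let B := [set t : Rn d | forall i, `|tnth t i - c i| < r] in
  measurable B /\ lebesgue_Rn R d B = ((r *+ 2) ^+ d)%:E.
Proof.
move=> r0 /=; elim: d c => [|d IH] c.
  rewrite (_ : [set _ | _] = setT); last by apply/seteqP; split => // t _ [].
  by split => //; rewrite expr0 /= diracT.
pose A : set (measurableTypeR R) := `]c ord0 - r, c ord0 + r[%classic.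
have [] := IH (c \o lift ord0).
set B' := [set _ | _] => mB' muB'.
set B := [set _ | _].
have BE : @tcons R d @^-1` B = A `*` B'.
  apply/seteqP; split=> [[x t] /= H|[x t] [/= xA H] i].
    split=> [|i]; last by have := H (lift ord0 i); rewrite tnthS.
    by have := H ord0; rewrite tnth0 ltr_distl /A /= in_itv.
  case: (unliftP ord0 i) => [j ->|->]; first by rewrite tnthS; exact: H.
  by rewrite tnth0 ltr_distl; move: xA; rewrite /A /= in_itv.
split.
  rewrite (_ : B = \bigcap_(i in [set: 'I_d.+1])
    ((@tnth _ _ ^~ i) @^-1` `]c i - r, c i + r[%classic)).
    apply: fin_bigcap_measurable; first exact: finite_finset.
    move=> i _; rewrite -[X in measurable X]setTI.
    by apply: measurable_tnth => //; exact: measurable_itv.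
  apply/seteqP; split=> [t tB i _|t tB i].
    by rewrite /= in_itv/= -ltr_distl; exact: tB.
  by have := tB i I; rewrite /= in_itv/= -ltr_distl.
transitivity ((lebesgue_measure \x lebesgue_Rn R d)%E (A `*` B')).
  by rewrite -BE.
rewrite [LHS](@product_measure1E _ _ _ _ R lebesgue_measure (lebesgue_Rn R d))//; last exact: measurable_itv.
rewrite muB' [X in (X * _)%E](lebesgue_measure_itv `]c ord0 - r, c ord0 + r[)/= lte_fin.
rewrite ifT; last by rewrite ltrBlDr -addrA ltrDl addr_gt0.
by rewrite -EFinB -EFinM exprS; congr (_ * _)%:E; ring.
Qed.

Lemma rintegrable_meas d (g : 'rV[R]_d -> R) : rintegrable g -> rmeas g.
Proof. by move=> /integrableP[/measurable_EFinP]. Qed.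

Lemma rintegrable_le d (f g : 'rV[R]_d -> R) : rmeas f ->
  (forall x, `|f x| <= g x) -> rintegrable g -> rintegrable f.
Proof.
move=> mf fg ig; apply: le_integrable ig => //; first exact/measurable_EFinP.
by move=> x _ /=; rewrite lee_fin (le_trans (fg _))// ler_norm.
Qed.

Lemma rintegrableZ d (c : R) (g : 'rV[R]_d -> R) :
  rintegrable g -> rintegrable (fun x => c * g x).
Proof. by move=> ig; exact: (integrableZl _ c ig). Qed.

Lemma rintegrableD d (f g : 'rV[R]_d -> R) :
  rintegrable f -> rintegrable g -> rintegrable (fun x => f x + g x).
Proof. by move=> If Ig; exact: (integrableD _ If Ig). Qed.

Lemma rintegrable_norm d (g : 'rV[R]_d -> R) :
  rintegrable g -> rintegrable (fun x => `|g x|).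
Proof. by move=> ig; exact: (integrable_abse ig). Qed.

Lemma rintZ d (c : R) (g : 'rV[R]_d -> R) :
  rintegrable g -> rint (fun x => c * g x) = c * rint g.
Proof. by move=> ig; exact: RintegralZl. Qed.

Lemma rintD d (f g : 'rV[R]_d -> R) : rintegrable f -> rintegrable g ->
  rint (fun x => f x + g x) = rint f + rint g.
Proof. by move=> If Ig; exact: RintegralD. Qed.

Lemma le_rint d (f g : 'rV[R]_d -> R) : rintegrable f -> rintegrable g ->
  (forall x, f x <= g x) -> rint f <= rint g.
Proof. by move=> If Ig fg; apply: le_Rintegral. Qed.

Lemma norm_rint d (g : 'rV[R]_d -> R) : rintegrable g ->
  `|rint g| <= rint (fun x => `|g x|).
Proof. by move=> ig; exact: le_normr_Rintegral. Qed.

End Rn.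

(** * Orthogonality to the derivatives of the Riesz kernel *)

Section kernels.
Variables (R : realType) (d : nat).
Local Notation Rd := 'rV[R]_d.
Implicit Types (v y a : Rd) (j m n : nat) (b : R).

(** The squared Euclidean length. Balls and continuity refer to the sup norm, so the two are
    compared in [norm_qd] and [qd_norm]. *)
Definition qd y : R := \sum_i y 0 i ^+ 2.
Definition dot v y : R := \sum_i v 0 i * y 0 i.
(** The exponent is halved, <v,y>^j |y|^(-2b), so that a derivation raises b by exactly 1. At the
    origin [powR] gives 0 as soon as b is nonzero. *)
Definition ker v j b y : R := dot v y ^+ j * qd y `^ (- b).
(** The derivative of [ker v j b] in the direction v. For j = 0 the default value of [j.-1] is
    multiplied by 0. *)
Definition dker v j b y : R :=
  j%:R * qd v * ker v j.-1 b y - 2 * b * ker v j.+1 (b + 1) y.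

Lemma qd_ge0 y : 0 <= qd y.
Proof. by apply: sumr_ge0 => i _; exact: sqr_ge0. Qed.

Lemma norm_qd y : `|y| ^+ 2 <= qd y.
Proof.
have [->|y0] := eqVneq y 0; first by rewrite normr0 expr0n/= qd_ge0.
have [[i k] yik] : exists i, `|y| = `|y i.1 i.2| by apply: mx_norm_neq0; rewrite -[mx_norm y]/(`|y|) normr_eq0.
rewrite yik /= ord1 real_normK ?num_real// /qd (bigD1 k)//= lerDl.
by apply: sumr_ge0 => l _; exact: sqr_ge0.
Qed.

Lemma qd_norm y : qd y <= d%:R * `|y| ^+ 2.
Proof.
apply: le_trans (_ : \sum_(i < d) `|y| ^+ 2 <= _).
  apply: ler_sum => i _; rewrite -real_normK ?num_real// ler_sqr ?nnegrE//.
  exact: row_norm_ge.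
by rewrite sumr_const card_ord mulr_natl.
Qed.

Lemma dot_qd v y : `|dot v y| <= qd v + qd y.
Proof.
apply: le_trans (ler_norm_sum _ _ _) _; rewrite -big_split/=; apply: ler_sum => i _.
rewrite normrM -[X in _ <= X + _]real_normK ?num_real// -[X in _ <= _ + X]real_normK ?num_real//.
set s := `|_|; set t := `|_|; nra.
Qed.

Lemma dotD v y z : dot v (y + z) = dot v y + dot v z.
Proof. by rewrite -big_split; apply: eq_bigr => i _; rewrite mxE mulrDr. Qed.

Lemma dotZ v t y : dot v (t *: y) = t * dot v y.
Proof. by rewrite mulr_sumr; apply: eq_bigr => i _; rewrite mxE; ring. Qed.

Lemma dotvv v : dot v v = qd v.
Proof. by apply: eq_bigr => i _; rewrite expr2. Qed.

Lemma qdD y z : qd (y + z) = qd y + 2 * dot z y + qd z.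
Proof.
by rewrite mulr_sumr -!big_split; apply: eq_bigr => i _; rewrite mxE /=; ring.
Qed.

Lemma qdZ t y : qd (t *: y) = t ^+ 2 * qd y.
Proof. by rewrite mulr_sumr; apply: eq_bigr => i _; rewrite mxE; ring. Qed.

Lemma qdD_le y z : qd (y + z) <= 2 * qd y + 2 * qd z.
Proof.
rewrite !mulr_sumr -big_split; apply: ler_sum => i _ /=; rewrite mxE.
set s := y 0 i; set t := z 0 i; rewrite -subr_ge0.
by rewrite (_ : _ - _ = (s - t) ^+ 2) ?sqr_ge0//; ring.
Qed.

Lemma dotC v y : dot v y = dot y v.
Proof. by apply: eq_bigr => i _; rewrite mulrC. Qed.

Lemma is_derive_ker v j b y (t : R) : 0 < qd (y + t *: v) ->
  is_derive t 1 (fun t => ker v j b (y + t *: v)) (dker v j b (y + t *: v)).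
Proof.
move=> Q0.
pose u (s : R) := dot v y + s * qd v.
pose p (s : R) := qd y + s * (2 * dot v y) + s ^+ 2 * qd v.
have uE s : dot v (y + s *: v) = u s by rewrite dotD dotZ dotvv.
have pE s : qd (y + s *: v) = p s.
  by rewrite qdD qdZ [dot _ y]dotC dotZ dotC /p; ring.
have du : is_derive t 1 u (qd v).
  by apply: is_derive_eq; rewrite /GRing.scale/=; ring.
have dp : is_derive t 1 p (2 * u t).
  by apply: is_derive_eq; rewrite /u /GRing.scale/=; ring.
pose w (s : R) := p s `^ (- b).
have uX s : (u ^+ j) s = u s ^+ j by rewrite exprfctE.
rewrite (_ : (fun t => _) = (u ^+ j) * w); last first.
  by apply/funext => s; rewrite /ker uE pE -uX.
have dpw : is_derive t 1 w (- b * p t `^ (- b - 1) * (2 * u t)).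
  have p0 : 0 < p t by rewrite -pE.
  exact: (@is_derive1_comp _ (fun x => x `^ (- b)) p t _ _ (is_derive1_powR (- b) p0) dp).
apply: is_derive_eq; rewrite uX.
rewrite /dker /ker uE pE /GRing.scale/= opprD exprS /w; ring.
Qed.

(** The bound is asked only away from the pole; [e] is the square of the radius. *)
Definition rho_bounded (e : R) (h : Rd -> R) :=
  exists K, forall y, e <= qd y -> `|h y| <= K.

(** Away from the origin [dot_qd] bounds |<v,y>| by a constant times |y|^2, so the kernel is
    O(|y|^(2j-2b)). Counting <v,y> as |y|^2 is crude, but the resulting condition j <= b is stable:
    the derivation that raises j raises b as well. *)
Lemma ker_bounded v j b (e : R) : 0 < e -> j%:R <= b -> rho_bounded e (ker v j b).
Proof.
move=> e0 jb; exists ((qd v / e + 1) ^+ j * e `^ (j%:R - b)) => y ey.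
have Q0 : 0 < qd y by exact: lt_le_trans ey.
have C0 : 0 <= qd v / e + 1 by rewrite addr_ge0// divr_ge0 ?qd_ge0// ltW.
rewrite /ker normrM normrX (ger0_norm (powR_ge0 _ _)).
apply: le_trans (_ : ((qd v / e + 1) * qd y) ^+ j * qd y `^ (- b) <= _).
  rewrite ler_wpM2r ?powR_ge0// lerXn2r ?nnegrE//.
    by rewrite mulr_ge0 ?qd_ge0.
  apply: le_trans (dot_qd _ _) _.
  rewrite mulrDl mul1r lerD2r -mulrA ler_peMr ?qd_ge0//.
  by rewrite mulrC ler_pdivlMr// mul1r.
rewrite exprMn -mulrA ler_wpM2l ?exprn_ge0//.
rewrite -powR_mulrn ?qd_ge0// -powRD; last by apply/implyP => _; rewrite gt_eqF.
rewrite -(opprB b) !powRN lef_pV2 ?posrE ?powR_gt0//.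
by apply: ge0_ler_powR; rewrite ?subr_ge0 ?nnegrE ?qd_ge0 ?(ltW e0).
Qed.

Lemma rmeasD (f g : Rd -> R) : rmeas f -> rmeas g -> rmeas (fun x => f x + g x).
Proof. by move=> mf mg; exact: measurable_funD. Qed.

Lemma rmeasM (f g : Rd -> R) : rmeas f -> rmeas g -> rmeas (fun x => f x * g x).
Proof. by move=> mf mg; exact: measurable_funM. Qed.

Lemma rmeas_cst (c : R) : rmeas (fun _ : Rd => c).
Proof. exact: measurable_cst. Qed.

Lemma rmeas_ker v j b a : rmeas (fun x => ker v j b (x + a)).
Proof.
have mc i : rmeas (fun x : Rd => (x + a) 0 i).
  have -> : (fun x : Rd => (x + a) 0 i) = (fun x => x 0 i + a 0 i).
    by apply/funext => x; rewrite mxE.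
  by apply: rmeasD; [exact: rmeas_coord|exact: rmeas_cst].
apply: rmeasM.
  apply: (@measurableT_comp _ _ _ _ _ _ (fun x : R => x ^+ j)); first exact: exprn_measurable.
  apply: (@rmeas_sum R d _ (index_enum 'I_d) (fun i (x : Rd) => v 0 i * (x + a) 0 i)) => i.
  by apply: rmeasM; [exact: rmeas_cst|exact: mc].
apply: (@measurableT_comp _ _ _ _ _ _ (fun x : R => x `^ (- b))); first exact: measurable_powR.
apply: (@rmeas_sum R d _ (index_enum 'I_d) (fun i (x : Rd) => (x + a) 0 i ^+ 2)) => i.
rewrite (_ : (fun _ => _) = fun x => (x + a) 0 i * (x + a) 0 i); last by apply/funext => x; rewrite expr2.
by apply: rmeasM; exact: mc.
Qed.

Variables (G : Rd -> R) (rho : R).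
Hypotheses (rho0 : 0 < rho) (IG : rintegrable G).
Hypothesis G0 : forall x, `|x| < rho *+ 2 -> G x = 0.

(** [G] lives beyond 2 rho and shifts stay below rho, which leaves a margin rho around the pole of
    every shifted kernel. *)
Let far x a : `|a| < rho -> G x != 0 -> rho ^+ 2 <= qd (x - a).
Proof.
move=> ar Gx; apply: le_trans (norm_qd _).
rewrite lerXn2r ?nnegrE ?(ltW rho0)//.
have xr : rho *+ 2 <= `|x| by rewrite leNgt; apply: contra Gx => /G0/eqP.
have := lerB_dist x a; lra.
Qed.

(** Orthogonality is demanded for all small shifts, not just for a = 0, so that it can be
    differentiated in a. Measurability and the bound travel along to keep the integrals
    meaningful. *)
Definition annih (h : Rd -> R) :=
  [/\ forall a, rmeas (fun x => h (x + a)), rho_bounded (rho ^+ 2) h &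
   forall a, `|a| < rho -> rint (fun x => h (x - a) * G x) = 0].

Lemma annih_integrable (h : Rd -> R) a : (forall a, rmeas (fun x => h (x + a))) ->
  rho_bounded (rho ^+ 2) h -> `|a| < rho -> rintegrable (fun x => h (x - a) * G x).
Proof.
move=> mh [K hK] ar.
apply: (@rintegrable_le _ _ _ (fun x => K * `|G x|)).
- by apply: rmeasM; [exact: mh|exact: rintegrable_meas].
- move=> x; rewrite normrM; have [->|Gx] := eqVneq (G x) 0; first by rewrite normr0 !mulr0.
  by rewrite ler_wpM2r// hK// far.
- by apply: rintegrableZ; exact: rintegrable_norm.
Qed.

Lemma annih_lin c1 c2 (h1 h2 : Rd -> R) : annih h1 -> annih h2 ->
  annih (fun y : Rd => c1 * h1 y + c2 * h2 y).
Proof.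
move=> [m1 b1 i1] [m2 b2 i2]; split.
- by move=> a; apply: rmeasD; apply: rmeasM => //; exact: rmeas_cst.
- move: b1 b2 => [K1 b1] [K2 b2]; exists (`|c1| * K1 + `|c2| * K2) => y ey.
  by rewrite (le_trans (ler_normD _ _))// lerD// normrM ler_wpM2l ?b1 ?b2.
- move=> a ar.
  rewrite (_ : (fun _ => _) = fun x => c1 * (h1 (x - a) * G x) + c2 * (h2 (x - a) * G x)); last first.
    by apply/funext => x; ring.
  by rewrite rintD ?rintZ ?i1 ?i2 ?mulr0 ?addr0//; do ?apply: rintegrableZ; exact: annih_integrable.
Qed.

Lemma annih_sum (I : Type) (s : seq I) (h : I -> Rd -> R) : annih (fun=> 0) ->
  (forall i, annih (h i)) -> annih (fun y : Rd => \sum_(i <- s) h i y).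
Proof.
move=> A0 Ah; elim: s => [|i s IH].
  by rewrite (_ : (fun _ => _) = fun=> 0)//; apply/funext => y; rewrite big_nil.
rewrite (_ : (fun _ => _) = fun y : Rd => 1 * h i y + 1 * \sum_(i <- s) h i y); last first.
  by apply/funext => y; rewrite big_cons !mul1r.
exact: annih_lin.
Qed.

Lemma annih0 : annih (fun=> 0).
Proof.
split=> [a||a ar]; first exact: rmeas_cst.
  by exists 0 => y _; rewrite normr0.
rewrite (_ : (fun _ => _) = fun x => 0 * G x); last by apply/funext => x; ring.
by rewrite rintZ// mul0r.
Qed.

(** The vanishing integral is differentiated along a - t v, whose sign turns the derivative in t
    into [dker] itself. The margin around the pole bounds the differentiated kernel by a constant K,
    and K |G| dominates the derivatives under the integral. *)
Lemma annih_dker v j b : j%:R <= b -> annih (ker v j b) -> annih (dker v j b).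
Proof.
move=> jb [mk bk ik].
have e0 : 0 < rho ^+ 2 by rewrite exprn_gt0.
have j1b : j.-1%:R <= b by rewrite (le_trans _ jb)// ler_nat leq_pred.
have j2b : j.+1%:R <= b + 1 by rewrite -natr1 lerD2r.
have bd : rho_bounded (rho ^+ 2) (dker v j b).
  have [K1 b1] := ker_bounded v e0 j1b; have [K2 b2] := ker_bounded v e0 j2b.
  exists (`|j%:R * qd v| * K1 + `|2 * b| * K2) => y ey.
  by rewrite (le_trans (ler_normB _ _))// lerD// normrM ler_wpM2l ?b1 ?b2.
split => //.
  move=> a; rewrite /dker.
  rewrite (_ : (fun _ => _) = fun x => j%:R * qd v * ker v j.-1 b (x + a) + - (2 * b) * ker v j.+1 (b + 1) (x + a)).
    by apply: rmeasD; apply: rmeasM; [exact: rmeas_cst|exact: rmeas_ker|exact: rmeas_cst|exact: rmeas_ker].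
  by apply/funext => x; rewrite mulNr.
move=> a ar.
have [K hK] := bd.
(* For |t| < dl the shift a - t v stays below rho; the 1 in the denominator covers v = 0. *)
pose dl := (rho - `|a|) / (`|v| + 1).
have dl0 : 0 < dl by rewrite divr_gt0 ?subr_gt0 ?ltr_wpDl.
have small (t : R) : t \in `](- dl), dl[ -> `|a - t *: v| < rho.
  rewrite in_itv/= -ltr_norml => tdl.
  apply: le_lt_trans (ler_normB _ _) _.
  rewrite mx_normZ -ltrBrDl; apply: le_lt_trans (_ : `|t| * (`|v| + 1) < _).
    by rewrite ler_wpM2l// lerDl.
  by rewrite -ltr_pdivlMr// ltr_wpDl.
pose f (t : R) (s : d.-tuple (measurableTypeR R)) :=
  ker v j b (\row_i tnth s i - a + t *: v) * G (\row_i tnth s i).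
have fE t s : f t s = ker v j b (\row_i tnth s i - (a - t *: v)) * G (\row_i tnth s i).
  by rewrite /f opprB addrA addrAC.
have df t s : t \in `](- dl), dl[ -> is_derive t 1 (f^~ s)
    (dker v j b (\row_i tnth s i - a + t *: v) * G (\row_i tnth s i)).
  move=> tdl; rewrite /f; have [->|Gx] := eqVneq (G (\row_i tnth s i)) 0.
    rewrite mulr0; under eq_fun do rewrite mulr0.
    exact: is_derive_cst.
  have Q0 : 0 < qd (\row_i tnth s i - a + t *: v).
    rewrite (_ : _ + _ = \row_i tnth s i - (a - t *: v)); last by rewrite opprB addrA addrAC.
    by rewrite (lt_le_trans e0)// far// small.
  have dk := @is_derive_ker v j b (\row_i tnth s i - a) t Q0.
  have := is_deriveM dk (is_derive_cst (G (\row_i tnth s i)) t 1).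
  by rewrite scaler0 add0r [_ *: _]mulrC.
clearbody f.
have := @cvg_differentiation_under_integral R _ _ (lebesgue_Rn R d) f setT measurableT 0 (- dl) dl.
have I0 : (`](- dl), dl[%classic : set R) 0 by rewrite /= in_itv/= oppr_lt0 dl0.
move=> /(_ I0).
have If t : t \in `](- dl), dl[ -> (lebesgue_Rn R d).-integrable setT (EFin \o f t).
  move=> tdl.
  have -> : EFin \o f t = (fun s => (ker v j b (\row_i tnth s i - (a - t *: v)) * G (\row_i tnth s i))%:E).
    by apply/funext => s; rewrite /= fE.
  exact: (annih_integrable mk bk (small _ tdl)).
move=> /(_ If).
have Df t s : t \in `](- dl), dl[ -> setT s -> derivable (f^~ s) t 1.
  by move=> tdl _; have [] := df t s tdl.
have D1 t s : t \in `](- dl), dl[ -> partial1of2 f t s =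
    dker v j b (\row_i tnth s i - a + t *: v) * G (\row_i tnth s i).
  by move=> tdl; rewrite partial1of2E; have [_ ->] := df t s tdl.
move=> /(_ Df (fun s => `|K| * `|G (\row_i tnth s i)|)).
have Kge0 s : 0 <= `|K| * `|G (\row_i tnth s i)| by rewrite mulr_ge0.
move=> /(_ Kge0).
have IK : (lebesgue_Rn R d).-integrable setT (EFin \o (fun s => `|K| * `|G (\row_i tnth s i)|)).
  exact: (rintegrableZ `|K| (rintegrable_norm IG)).
move=> /(_ IK).
have bK t s : t \in `](- dl), dl[ -> setT s ->
    `|partial1of2 f t s| <= `|K| * `|G (\row_i tnth s i)|.
  move=> tdl _; rewrite (D1 _ _ tdl) normrM.
  have [->|Gx] := eqVneq (G (\row_i tnth s i)) 0; first by rewrite normr0 !mulr0.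
  rewrite ler_wpM2r// (le_trans _ (ler_norm _))// hK//.
  rewrite (_ : _ + _ = \row_i tnth s i - (a - t *: v)); last by rewrite opprB addrA addrAC.
  by rewrite far// small.
move=> /(_ bK).
have -> : \int[lebesgue_Rn R d]_(y in setT) partial1of2 f 0 y = rint (fun x => dker v j b (x - a) * G x).
  have -> // : partial1of2 f 0 = (fun s => dker v j b (\row_i tnth s i - a) * G (\row_i tnth s i)).
  by apply/funext => s; rewrite (D1 _ _ I0) scale0r addr0.
have F0 t : t \in `](- dl), dl[ -> \int[lebesgue_Rn R d]_(y in setT) f t y = 0.
  move=> tdl.
  have -> : f t = (fun s => ker v j b (\row_i tnth s i - (a - t *: v)) * G (\row_i tnth s i)).
    by apply/funext => s; exact: fE.
  exact: (ik _ (small _ tdl)).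
(* The integral is 0 for every t in the interval, so all its difference quotients are 0, and so is
   the limit just computed. *)
move=> cv.
apply: (cvg_unique _ cv) => //=.
apply: cvg_near_cst.
near=> h; rewrite addr0.
have hdl : h \in `](- dl), dl[.
  rewrite in_itv/= -ltr_norml; near: h; exact: dnbhs0_lt.
by rewrite (F0 _ hdl) (F0 0)// subr0 scaler0.
Unshelve. all: by end_near. Qed.

(** Also true at the origin, where both powers have the value 0; this lets identities between
    kernels hold at every point. *)
Lemma qd_powRS b y : 0 < b -> qd y * qd y `^ (- (b + 1)) = qd y `^ (- b).
Proof.
move=> b0; have [->|Q0] := eqVneq (qd y) 0.
  by rewrite mul0r powR0// oppr_eq0 gt_eqF.
rewrite -[X in X * _]powRr1 ?qd_ge0// -powRD ?Q0 ?implybT//.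
by congr (_ `^ _); ring.
Qed.

Lemma dot_delta i y : dot (delta_mx 0 i) y = y 0 i.
Proof.
rewrite /dot (bigD1 i)//= mxE !eqxx mul1r big1 ?addr0// => k ki.
by rewrite mxE eqxx (negbTE ki) mul0r.
Qed.

(* The case j = 0, then j = 1, of the derivative in each direction e_i sums up to
   the Laplacian, which acts as
   Delta |y|^(-2b) = 2b (2b + 2 - d) |y|^(-2(b+1)). *)
Lemma annih_laplace b : 0 < b -> 2 * (b + 1) != d%:R ->
  annih (ker 0 0 b) -> annih (ker 0 0 (b + 1)).
Proof.
move=> b0 bd A0.
have kE v c : ker v 0 c = ker 0 0 c by apply/funext => y; rewrite /ker !expr0.
have A1 i : annih (ker (delta_mx 0 i) 1 (b + 1)).
  have := @annih_dker (delta_mx 0 i) 0 b (ltW b0).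
  rewrite kE => /(_ A0) A.
  have b2 : 2 * b != 0 by rewrite mulf_neq0 ?gt_eqF.
  rewrite (_ : ker _ _ _ = fun y => (- (2 * b)^-1) * dker (delta_mx 0 i) 0 b y + 0 * 0).
    by apply: annih_lin => //; exact: annih0.
  by apply/funext => y; rewrite /dker !mul0r sub0r addr0 mulrNN mulKf.
have A2 i : annih (dker (delta_mx 0 i) 1 (b + 1)).
  by apply: annih_dker; [rewrite lerDr ltW|exact: A1].
have c0 : d%:R - 2 * (b + 1) != 0 by rewrite subr_eq0 eq_sym.
rewrite (_ : ker _ _ _ = fun y => (d%:R - 2 * (b + 1))^-1 *
   (\sum_i dker (delta_mx 0 i) 1 (b + 1) y) + 0 * 0).
  apply: annih_lin; last exact: annih0.
  by apply: (annih_sum _ annih0).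
apply/funext => y; rewrite mul0r addr0.
rewrite (_ : \sum_i _ = (d%:R - 2 * (b + 1)) * ker 0 0 (b + 1) y) ?mulKf//.
under eq_bigr => i _.
  rewrite /dker kE mul1r /ker dot_delta -dotvv dot_delta mxE !eqxx mul1r.
  over.
rewrite sumrB sumr_const card_ord -mulr_sumr -mulr_suml -/(qd y) qd_powRS ?addr_gt0//.
by rewrite mulrBl /ker expr0 mul1r [d%:R * _]mulr_natl.
Qed.

(** * Kernels obtained from the radial one, and their concentration at a point *)

Section main_kernel.
Variable beta : R.
Hypotheses (beta0 : 0 < beta) (betaN : forall m : nat, 2 * (beta + m.+1%:R) != d%:R).
Hypothesis annih_base : annih (ker 0 0 beta).

Lemma annih_radial m : annih (ker 0 0 (beta + m%:R)).
Proof.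
elim: m => [|m IH]; first by rewrite addr0.
rewrite -natr1 addrA; apply: annih_laplace => //; first by rewrite ltr_wpDr.
by rewrite -addrA natr1.
Qed.

(** The formula for [dker v j b] is solved for its top term, of degree j+1 and exponent b+1. Degree
    j+1 draws on degrees j and j-1 at exponent m, hence the strong induction; j and m grow together,
    which keeps j <= m. *)
Lemma annih_ker v j m : (j <= m)%N -> annih (ker v j (beta + m%:R)).
Proof.
have [n] := ubnP j; elim: n j m => [|n IH] [|j] m; [by move=> ?; exfalso|by move=> ?; exfalso| |]; rewrite ltnS => jn jm.
  rewrite (_ : ker v 0 _ = ker 0 0 (beta + m%:R)); first exact: annih_radial.
  by apply/funext => y; rewrite /ker !expr0.
case: m jm => [|m]; [by move=> ?; exfalso|rewrite ltnS => jm].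
have jb : j%:R <= beta + m%:R by rewrite ler_wpDl ?ler_nat// ltW.
have Aj := annih_dker jb (IH _ _ jn jm).
have Aj1 : annih (ker v j.-1 (beta + m%:R)).
  apply: IH; first by rewrite (leq_ltn_trans (leq_pred _)).
  by rewrite (leq_trans (leq_pred _)).
have b0 : 0 < beta + m%:R by rewrite ltr_wpDr.
have b2 : 2 * (beta + m%:R) != 0 by rewrite mulf_neq0 ?gt_eqF.
rewrite -natr1 addrA.
have -> : ker v j.+1 (beta + m%:R + 1) = fun y => (- (2 * (beta + m%:R))^-1) * dker v j (beta + m%:R) y +
   (2 * (beta + m%:R))^-1 * (j%:R * qd v) * ker v j.-1 (beta + m%:R) y.
  apply/funext => y; rewrite /dker; field; lra.
exact: annih_lin.
Qed.

(** With z = y/|y|^2 the base is A + B |z|^2 + C <v,z>. Multiplying by it splits a kernel into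
    three: A leaves (j, m), B gives (j, m+1) and C gives (j+1, m+1), all with j <= m preserved. *)
Lemma annih_poly (v : Rd) (A B C : R) n j m : (j <= m)%N ->
  annih (fun y => (A + (B + C * dot v y) / qd y) ^+ n * ker v j (beta + m%:R) y).
Proof.
elim: n j m => [|n IH] j m jm.
  rewrite (_ : (fun _ => _) = ker v j (beta + m%:R)); first exact: annih_ker.
  by apply/funext => y; rewrite expr0 mul1r.
set q := fun y : Rd => A + (B + C * dot v y) / qd y.
rewrite (_ : (fun _ => _) = fun y =>
   1 * (A * (q y ^+ n * ker v j (beta + m%:R) y) + B * (q y ^+ n * ker v j (beta + m.+1%:R) y)) +
   C * (q y ^+ n * ker v j.+1 (beta + m.+1%:R) y)).
  apply: annih_lin; last exact: IH.
  by apply: annih_lin; apply: IH => //; rewrite leqW.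
apply/funext => y; rewrite -/(q y).
have b0 : 0 < beta + m%:R by rewrite ltr_wpDr.
rewrite /ker -natr1 addrA -(qd_powRS y b0) mul1r [in LHS]exprS.
have [Q0|Q0] := eqVneq (qd y) 0.
  rewrite Q0 mul0r powR0; first by rewrite !mulr0 !addr0.
  by rewrite oppr_eq0 gt_eqF// addr_gt0.
rewrite {1}/q exprS; move: (q y ^+ n) (qd y `^ _) => r s; field.
exact: Q0.
Qed.

Hypothesis cG : continuous G.

(* The kernels q^n |y|^(-2 beta), q = 1 - c |y - y0|^2 / |y|^2, concentrate at y0.
   Since |y - y0| / (|y| |y0|) is the distance of y / |y|^2 and y0 / |y0|^2,
   these are Landau kernels in the Kelvin transform of y. *)
Lemma annih_not_gt0 (y0 : Rd) : ~ 0 < G y0.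
Proof.
move=> Gy0.
pose N := qd y0.
have N0 : 0 <= N := qd_ge0 y0.
(* Makes q nonnegative where [G] is nonzero: there |y| >= rho, so |y - y0|^2 <= 2 |y|^2 + 2 N <=
   |y|^2 / c. *)
pose c := (2 * (1 + N / rho ^+ 2))^-1.
have r2 : 0 < rho ^+ 2 by rewrite exprn_gt0.
have Nr : 0 <= N / rho ^+ 2 by rewrite divr_ge0// ltW.
have c0 : 0 < c by rewrite invr_gt0 mulr_gt0// ltr_wpDr.
have c1 : c <= 2^-1.
  by rewrite lef_pV2 ?posrE ?mulr_gt0 ?ltr_wpDr// ler_peMr// lerDl.
have /cvgrPdist_lt/(_ (G y0 / 2)) := @cG y0.
rewrite divr_gt0// => /(_ isT) /nbhs_ballP[dl /= dl0 Hdl].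
have Gdl y : `|y0 - y| < dl -> G y0 / 2 < G y.
  move=> yd; have := Hdl y; rewrite -ball_normE /ball_/= => /(_ yd).
  by rewrite ltr_norml => /andP[_]; lra.
(* If |y0 - y| >= dl then |y|^2 <= 2 |y - y0|^2 + 2 N <= |y - y0|^2 / kap, so the quotient |y -
   y0|^2 / |y|^2 is at least kap. *)
pose kap := (2 + 2 * N / dl ^+ 2)^-1.
have d2 : 0 < dl ^+ 2 by rewrite exprn_gt0.
have Nd : 0 <= 2 * N / dl ^+ 2 by rewrite divr_ge0 ?mulr_ge0// ltW.
have k0 : 0 < kap by rewrite invr_gt0 ltr_wpDr.
have k1 : kap <= 2^-1 by rewrite lef_pV2 ?posrE// ?ltr_wpDr// lerDl.
(* The two competing rates: where [G] is nonzero, q is at most [th] outside the dl-ball of y0, and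
   at least [th'] on a smaller ball. *)
pose th := 1 - c * kap; pose th' := 1 - c * kap / 2.
have ck0 : 0 < c * kap by rewrite mulr_gt0.
have ck1 : c * kap <= 2^-1 by rewrite -[leRHS]mulr1 ler_pM// ?ltW//; lra.
have th0 : 0 < th by rewrite /th; lra.
have thth' : th < th' by rewrite /th /th'; lra.
(* The bound dl keeps G above G y0 / 2. The bound 1 lets |y - y0|^2 be estimated by e, and the last
   one then makes the squared Euclidean distance at most rho^2 kap / 2, half of what would bring q
   down to [th] at |y| = rho. *)
pose e := Num.min dl (Num.min 1 (rho ^+ 2 * kap / 2 / (d%:R + 1))).
have e0 : 0 < e.
  rewrite !lt_min dl0 ltr01 /= divr_gt0// ?ltr_wpDl//.
  by rewrite divr_gt0// mulr_gt0.
have ed : e <= dl by rewrite ge_min lexx.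
have e1 : e <= 1 by rewrite !ge_min lexx orbT.
have ek : (d%:R + 1) * e <= rho ^+ 2 * kap / 2.
  rewrite mulrC -ler_pdivlMr ?ltr_wpDl//.
  by rewrite !ge_min lexx !orbT.
have dR0 : (0 : R) <= d%:R by [].
have qde y : `|y0 - y| < e -> qd (y - y0) <= rho ^+ 2 * kap / 2.
  move=> ye; apply: le_trans (qd_norm _) _; apply: le_trans ek.
  rewrite distrC in ye.
  have n0 := normr_ge0 (y - y0).
  have t2 : `|y - y0| ^+ 2 <= e by set t := `|y - y0| in ye n0 *; nra.
  by apply: le_trans (ler_wpM2l dR0 t2) _; rewrite ler_pM2r// lerDl.
(* 1 - c |y - y0|^2 / |y|^2 expanded into the form that [annih_poly] accepts. *)
pose q y := (1 - c) + (- (c * N) + (2 * c) * dot y0 y) / qd y.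
have qE y : qd y != 0 -> q y = 1 - c * (qd (y - y0) / qd y).
  move=> Q0; rewrite /q qdD -[- y0]scaleN1r qdZ [dot (_ *: _) _]dotC dotZ dotC -/N.
  by field.
have Gfar y : G y != 0 -> rho ^+ 2 <= qd y.
  by move=> Gy; rewrite -[y]subr0; apply: far => //; rewrite normr0.
have Gpos y : G y != 0 -> 0 < qd y by move=> /Gfar; apply: lt_le_trans.
have qge0 y : G y != 0 -> 0 <= q y.
  move=> Gy; have Q0 := Gpos y Gy; have Qr := Gfar y Gy.
  rewrite qE ?gt_eqF// subr_ge0 mulrA ler_pdivrMr// mul1r.
  have D := qdD_le y (- y0); rewrite -[- y0]scaleN1r qdZ sqrrN expr1n mul1r -/N scaleN1r in D.
  have cE : c * (2 * (1 + N / rho ^+ 2)) = 1.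
    by rewrite mulVf// gt_eqF// mulr_gt0// ltr_wpDr.
  have NQ : N <= N / rho ^+ 2 * qd y by rewrite mulrAC ler_pdivlMr// ler_wpM2l.
  apply: le_trans (_ : c * (2 * (1 + N / rho ^+ 2)) * qd y <= _); last by rewrite cE mul1r.
  by rewrite -mulrA ler_pM2l//; lra.
have qle y : G y != 0 -> dl <= `|y0 - y| -> q y <= th.
  move=> Gy yd; have Q0 := Gpos y Gy.
  rewrite qE ?gt_eqF// lerD2l lerN2 ler_pM2l// ler_pdivlMr//.
  have D := qdD_le (y - y0) y0; rewrite subrK -/N in D.
  have DD : dl ^+ 2 <= qd (y - y0).
    apply: le_trans (norm_qd _); rewrite distrC lerXn2r ?nnegrE//; exact: ltW.
  have kE : kap * (2 + 2 * N / dl ^+ 2) = 1 by rewrite mulVf// gt_eqF// ltr_wpDr.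
  have ND : 2 * N <= 2 * N / dl ^+ 2 * qd (y - y0).
    by rewrite mulrAC ler_pdivlMr// ler_wpM2l// mulr_ge0.
  apply: le_trans (_ : kap * (2 + 2 * N / dl ^+ 2) * qd (y - y0) <= _); last by rewrite kE mul1r.
  by rewrite -mulrA ler_pM2l//; lra.
have qge y : G y != 0 -> `|y0 - y| < e -> th' <= q y.
  move=> Gy ye; have Q0 := Gpos y Gy; have Qr := Gfar y Gy.
  rewrite qE ?gt_eqF// lerD2l lerN2 -mulrA ler_pM2l// ler_pdivrMr//.
  apply: le_trans (qde _ ye) _.
  by rewrite -mulrA mulrC ler_wpM2l// divr_ge0// ltW.
pose P y := qd y `^ (- beta).
have P0 y : 0 <= P y := powR_ge0 _ _.
(* An upper bound of |y|^2 on the e-ball of y0, so that P G >= m0 there. *)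
pose Qm := 2 * (rho ^+ 2 * kap / 2) + 2 * N.
pose m0 := Qm `^ (- beta) * (G y0 / 2).
have Qm0 : 0 < Qm by rewrite ltr_wpDr ?mulr_ge0// mulr_gt0// divr_gt0// mulr_gt0.
have m00 : 0 < m0 by rewrite mulr_gt0 ?divr_gt0// powR_gt0.
pose B := [set t : d.-tuple (measurableTypeR R) | forall i, `|tnth t i - y0 0 i| < e / 2].
have e20 : 0 < e / 2 by rewrite divr_gt0.
have [mB muB] := measure_box (fun i => y0 0 i) e20.
pose ind (x : Rd) : R := (`[< forall i, `|x 0 i - y0 0 i| < e / 2 >])%:R.
have indE : (fun t : d.-tuple (measurableTypeR R) => ind (\row_i tnth t i)) = \1_B.
  apply/funext => t; rewrite /ind indicE; congr (nat_of_bool _)%:R.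
  apply/asboolP/idP => [H|]; first by rewrite inE => i; have := H i; rewrite mxE.
  by rewrite inE => H i; rewrite mxE; exact: H.
have iB : (\int[lebesgue_Rn R d]_t (\1_B t)%:E = ((e / 2 *+ 2) ^+ d)%:E)%E.
  by rewrite integral_indic// setIT; exact: muB.
have indEE : (fun t : d.-tuple (measurableTypeR R) => (ind (\row_i tnth t i))%:E) = EFin \o \1_B.
  by rewrite -indE.
have Iind : rintegrable ind.
  rewrite /rintegrable indEE; apply/integrableP; split; first exact/measurable_EFinP.
  under eq_integral do rewrite gee0_abs ?lee_fin//.
  by rewrite iB ltry.
have rind : 0 < rint ind.
  rewrite /rint indE /Rintegral iB /= exprn_gt0// -mulr_natr divfK//.
pose W (x : Rd) := `|P x * G x|.
have Wge0 x : 0 <= W x by exact: normr_ge0.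
have r00 : `|0 : Rd| < rho by rewrite normr0.
have IW : rintegrable W.
  apply: rintegrable_norm; have [mk bk _] := annih_base.
  have := annih_integrable mk bk r00.
  rewrite (_ : (fun x => _) = fun x => P x * G x)//.
  by apply/funext => x; rewrite subr0 /ker expr0 mul1r.
(* Pointwise, q^n P G is at least th'^n m0 on the box, nonnegative on the rest of the dl-ball and at
   least - th^n W outside it. Its integral is 0, so the integral of the minorant is at most 0. *)
have key n : th' ^+ n * (m0 * rint ind) <= th ^+ n * rint W.
  have [mq bq iq] := @annih_poly y0 (1 - c) (- (c * N)) (2 * c) n 0 0 (leqnn _).
  have Iq := annih_integrable mq bq r00.
  have lhsE : rint (fun x => th' ^+ n * m0 * ind x + - th ^+ n * W x) =
      th' ^+ n * m0 * rint ind + - th ^+ n * rint W.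
    by rewrite rintD ?rintZ//; exact: rintegrableZ.
  rewrite mulrA -subr_le0 -mulNr -lhsE -(iq 0 r00).
  apply: le_rint => //; first by apply: rintegrableD; exact: rintegrableZ.
  move=> x; rewrite subr0 addr0 -/(q x) /ker expr0 mul1r -/(P x) -mulrA.
  have thn : 0 <= th ^+ n by rewrite exprn_ge0// ltW.
  rewrite /ind; case: asboolP => [H|_] /=.
    have xe : `|y0 - x| < e.
      apply: (@le_lt_trans _ _ (e / 2)); last by rewrite ltr_pdivrMr// mulr_natr mulr2n ltrDl.
      by apply: row_norm_le; [exact: ltW|move=> i; rewrite !mxE distrC ltW//; exact: H].
    have Gx : G y0 / 2 < G x by apply: Gdl; exact: lt_le_trans ed.
    have Gx0 : 0 < G x by apply: lt_trans Gx; rewrite divr_gt0.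
    rewrite mulr1n mulr1; apply: le_trans (_ : th' ^+ n * m0 <= _).
      by rewrite gerDl mulNr oppr_le0 mulr_ge0 ?Wge0.
    have th'q := qge x (lt0r_neq0 Gx0) xe.
    rewrite -mulrA ler_pM// ?exprn_ge0// ?(ltW m00)//; first exact: ltW (lt_trans th0 thth').
      by rewrite lerXn2r ?nnegrE// ?(le_trans _ th'q)//; exact: ltW (lt_trans th0 thth').
    rewrite /m0 ler_pM ?powR_ge0 ?divr_ge0 ?(ltW Gy0) ?(ltW Gx)//.
    rewrite /P !powRN lef_pV2 ?posrE ?powR_gt0// ?(Gpos _ (lt0r_neq0 Gx0))//.
    apply: ge0_ler_powR; rewrite ?nnegrE ?qd_ge0 ?(ltW Qm0) ?(ltW beta0)//.
    have := qdD_le (x - y0) y0; rewrite subrK -/N => /le_trans; apply.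
    by rewrite lerD2r ler_pM2l// qde.
  rewrite mulr0n mulr0 mulr0 add0r mulNr.
  have [Gx|Gx] := eqVneq (G x) 0; first by rewrite /W Gx !mulr0 normr0 mulr0 oppr0.
  have q0 := qge0 x Gx.
  have [xd|xd] := ltP `|y0 - x| dl.
    have Gx0 : 0 < G x by apply: lt_trans (Gdl x xd); rewrite divr_gt0.
    by apply: (@le_trans _ _ 0); [rewrite oppr_le0 mulr_ge0 ?Wge0|rewrite !mulr_ge0 ?exprn_ge0// ltW].
  have qt := qle x Gx xd.
  rewrite -mulrA lerNl; apply: le_trans (ler_norm _) _.
  rewrite normrN normrM (ger0_norm (exprn_ge0 n q0)) ler_wpM2r//.
  by rewrite lerXn2r ?nnegrE// (le_trans q0).
have W0 : 0 <= rint W by apply: Rintegral_ge0 => t _; exact: Wge0.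
have th'0 := lt_trans th0 thth'.
have z1 : `|th / th'| < 1.
  by rewrite ger0_norm ?divr_ge0 ?(ltW th0) ?(ltW th'0)// ltr_pdivrMr// mul1r.
have K0 : 0 < m0 * rint ind by rewrite mulr_gt0.
(* Since th / th' < 1, some n violates [key]; adding 1 to [rint W] keeps the denominator
   positive. *)
have /cvgrPdist_lt/(_ (m0 * rint ind / (rint W + 1))) := cvg_expr z1.
rewrite divr_gt0 ?ltr_wpDl// => /(_ isT)[n _ /(_ n (leqnn n))] /=.
rewrite sub0r normrN ger0_norm; last by rewrite exprn_ge0// divr_ge0 ?(ltW th0) ?(ltW th'0).
rewrite ltr_pdivlMr ?ltr_wpDl// expr_div_n mulrAC ltr_pdivrMr ?exprn_gt0//.
have := key n; rewrite mulrDr mulr1 => kn.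
have := exprn_gt0 n th0; lra.
Qed.

End main_kernel.
End kernels.

(** * Uniqueness for functions orthogonal to small translates of the Riesz kernel *)

Section uniqueness.
Variables (R : realType) (d : nat) (alpha rho : R).
Local Notation Rd := 'rV[R]_d.
Hypotheses (alpha0 : 0 < alpha) (rho0 : 0 < rho).
Hypothesis alphaZ : (alpha - d%:R) / 2 \isn't a Num.int.

Lemma enorm_powRN (y : Rd) : enorm y `^ (- alpha) = ker 0 0 (alpha / 2) y.
Proof.
rewrite /ker expr0 mul1r /enorm -/(qd y) -powR12_sqrt ?qd_ge0// -powRrM.
by congr (_ `^ _); field.
Qed.

(** A change of variables moves the shift from [G] to the kernel; positive values are then excluded
    for [G] and for its opposite. *)
Lemma riesz_kernel_eq0 (G : Rd -> R) : continuous G -> rintegrable G ->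
  (forall x, `|x| < rho *+ 2 -> G x = 0) ->
  (forall a, `|a| < rho -> rint (fun x => enorm x `^ (- alpha) * G (x + a)) = 0) ->
  forall x, G x = 0.
Proof.
move=> cG IG G0 Ga.
have mk a : rmeas (fun x : Rd => ker 0 0 (alpha / 2) (x + a)) by exact: rmeas_ker.
have bk : rho_bounded (rho ^+ 2) (ker (0 : Rd) 0 (alpha / 2)).
  by apply: ker_bounded; rewrite ?exprn_gt0// divr_ge0// ltW.
have ik a : `|a| < rho -> rint (fun x => ker 0 0 (alpha / 2) (x - a) * G x) = 0.
  move=> ar; rewrite -(rint_shift a).
    rewrite -(Ga _ ar); congr rint; apply/funext => y.
    by rewrite addrK enorm_powRN.
  by apply: rmeasM; [exact: rmeas_ker|exact: rintegrable_meas].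
have pos (H : Rd -> R) x : continuous H -> rintegrable H ->
    (forall x, `|x| < rho *+ 2 -> H x = 0) ->
    annih H rho (ker 0 0 (alpha / 2)) -> ~ 0 < H x.
  move=> cH IH H0 aH; apply: (@annih_not_gt0 _ _ _ _ rho0 IH H0 (alpha / 2)) => //.
  - by rewrite divr_gt0.
  (* An equality alpha + 2(m+1) = d would make (alpha - d)/2 the integer -(m+1). *)
  - move=> m; apply: contra alphaZ => /eqP dE.
    rewrite (_ : _ / 2 = (- (m.+1%:Z))%:~R) ?intr_int//.
    by rewrite -dE mulrNz -pmulrn; field.
move=> x; have [Gx|Gx|//] := ltgtP (G x) 0; last by case: (pos G x cG IG G0).
pose H y := - G y.
have IH : rintegrable H.
  rewrite (_ : H = fun y => -1 * G y); first exact: rintegrableZ.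
  by apply/funext => y; rewrite mulN1r.
case: (pos H x _ IH).
- by move=> y; apply: continuousN; exact: cG.
- by move=> y /G0; rewrite /H => ->; rewrite oppr0.
- split=> // a ar.
  rewrite (_ : (fun _ => _) = fun x => -1 * (ker 0 0 (alpha / 2) (x - a) * G x)); last first.
    by apply/funext => y; rewrite /H; ring.
  rewrite rintZ ?ik ?mulr0//.
  exact: (annih_integrable rho0 IG G0 mk bk ar).
- by rewrite oppr_gt0.
Qed.
End uniqueness.

(** * Smooth cutoffs *)

Section smooth_step.
Variable R : realType.
Implicit Types (f g : R -> R) (n : nat).

(** The derivative is an existential witness, so sums, products and compositions are handled by
    exhibiting the one that the usual rule provides. *)
Fixpoint nderivable n f : Prop :=
  if n is n'.+1 then
    exists f', (forall t : R, is_derive t 1 f (f' t)) /\ nderivable n' f'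
  else True.

Lemma nderivable_cst n (c : R) : nderivable n (cst c).
Proof.
elim: n c => //= n IH c; exists (cst 0); split => // t; exact: is_derive_cst.
Qed.

Lemma nderivableW n f : nderivable n.+1 f -> nderivable n f.
Proof.
elim: n f => // n IH f [f' [df Cf']].
by exists f'; split => //; exact: IH.
Qed.

Lemma nderivableD n f g : nderivable n f -> nderivable n g -> nderivable n (fun t => f t + g t).
Proof.
elim: n f g => // n IH f g [f' [df Cf]] [g' [dg Cg]].
exists (fun t => f' t + g' t); split; last exact: IH.
by move=> t; exact: (is_deriveD (df t) (dg t)).
Qed.

Lemma nderivableM n f g : nderivable n f -> nderivable n g -> nderivable n (fun t => f t * g t).
Proof.
elim: n f g => // n IH f g Cf Cg.
have Cf1 := nderivableW Cf; have Cg1 := nderivableW Cg.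
move: Cf Cg => [f' [df Cf']] [g' [dg Cg']].
exists (fun t => f t * g' t + g t * f' t); split.
  by move=> t; exact: (is_deriveM (df t) (dg t)).
by apply: nderivableD; exact: IH.
Qed.

Lemma nderivable_comp n f g : nderivable n f -> nderivable n g -> nderivable n (fun t => f (g t)).
Proof.
elim: n f g => // n IH f g [f' [df Cf']] Cg.
have Cg1 := nderivableW Cg; move: Cg => [g' [dg Cg']].
exists (fun t => f' (g t) * g' t); split.
  by move=> t; exact: (is_derive1_comp (df (g t)) (dg t)).
by apply: nderivableM => //; exact: IH.
Qed.

(** Each s^i exp(-s) is at most i!, by keeping one term of the exponential series. *)
Lemma expRN_poly_bounded (p : {poly R}) :
  exists C, forall s : R, 0 < s -> `|p.[s]| * expR (- s) <= C.
Proof.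
exists (\sum_(i < size p) `|p`_i| * (i`!)%:R) => s s0.
rewrite horner_coef; apply: le_trans (ler_wpM2r (expR_ge0 _) (ler_norm_sum _ _ _)) _.
rewrite mulr_suml; apply: ler_sum => i _.
rewrite normrM -mulrA ler_wpM2l// normrX (gtr0_norm s0).
rewrite expRN ler_pdivrMr ?expR_gt0//.
case: (nat_of_ord i) => [|n]; first by rewrite expr0 fact0 mul1r ltW// expR_gt1.
have := expR_ge1Dxn n (ltW s0); set c := (_`!)%:R => H.
have c0 : 0 < c :> R by rewrite ltr0n fact_gt0.
rewrite mulrC -ler_pdivrMr//; lra.
Qed.

(** The polynomial factor in 1/t closes the family under derivation: p becomes X^2 (p - p'). *)
Definition flat_exp (p : {poly R}) (t : R) : R :=
  if 0 < t then p.[t^-1] * expR (- t^-1) else 0.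

Lemma is_derive_cvg (f : R -> R) (t l : R) :
  (h^-1 * (f (h + t) - f t)) @[h --> 0^'] --> l -> is_derive t 1 f l.
Proof.
move=> H; have H' : (fun h => h^-1 *: ((f \o shift t) (h *: 1) - f t)) @ 0^' --> l.
  by move: H; rewrite /= /GRing.scale/=; under [in X in X -> _]eq_fun do rewrite -[X in f (X + t)]mulr1.
by apply: DeriveDef; [exact: cvgP H'|exact: cvg_lim H'].
Qed.

Lemma is_derive_flat_exp (p : {poly R}) (t : R) :
  is_derive t 1 (flat_exp p) (flat_exp ('X ^+ 2 * (p - p^`())) t).
Proof.
have [t0|t0|->] := ltgtP t 0.
- rewrite /flat_exp [in X in is_derive _ _ _ X]ifF; last by apply/negbTE; rewrite -leNgt ltW.
  apply: (near_eq_is_derive (f := cst 0)).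
  near=> s; rewrite ifF//; apply/negbTE; rewrite -leNgt ltW//.
  by near: s; exact: lt_nbhsl.
- have dV : is_derive t 1 (fun s : R => s^-1) (- t ^- 2).
    have := @is_deriveV R id t 1 1 (lt0r_neq0 t0) (is_derive_id _ _).
    by rewrite /GRing.scale/= mulr1.
  have dp := is_derive1_comp (is_derive_poly p t^-1) dV.
  have dN : is_derive t 1 (fun s : R => - s^-1) (- - t ^- 2) by exact: is_deriveN.
  have de := @is_derive1_comp _ expR (fun s : R => - s^-1) t _ _ (is_derive_expR (- t^-1)) dN.
  have dpe := is_deriveM dp de.
  have H : is_derive t 1 (fun s => p.[s^-1] * expR (- s^-1)) (flat_exp ('X ^+ 2 * (p - p^`())) t).
    move: dpe; set l := (X in is_derive _ _ _ X).
    suff -> : l = flat_exp ('X ^+ 2 * (p - p^`())) t by [].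
    rewrite /l /flat_exp t0 !hornerE /GRing.scale/=; field.
    exact: lt0r_neq0.
  apply: near_eq_is_derive H.
  by near=> s; rewrite /flat_exp ifT//; near: s; exact: lt_nbhsr.
apply: is_derive_cvg.
rewrite {2 3}/flat_exp ltxx.
(* For h > 0 the difference quotient at 0 is h times h^(-2) p(1/h) exp(-1/h), and that last product
   is bounded. *)
have [C HC] := expRN_poly_bounded (p * 'X ^+ 2).
have C0 : 0 <= C by apply: le_trans (HC 1 ltr01); rewrite mulr_ge0// expR_ge0.
apply/cvgrPdist_le => e e0.
have eC : 0 < e / (C + 1) by rewrite divr_gt0// ltr_wpDl.
near=> h.
rewrite sub0r normrN addr0 subr0 /flat_exp.
have [h0|h0] := ltP 0 h; last by rewrite mulr0 normr0 ltW.
have hC : `|h| < e / (C + 1).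
  by near: h; exact: dnbhs0_lt.
have := HC h^-1; rewrite invr_gt0 => /(_ h0); rewrite !hornerE normrM.
rewrite ltr_pdivlMr ?ltr_wpDl// gtr0_norm// in hC.
rewrite !normrM (ger0_norm (expR_ge0 _)) normfV (gtr0_norm h0) => H.
apply: le_trans (_ : h * C <= _); last by rewrite (le_trans _ (ltW hC))// ler_pM2l// lerDl.
rewrite -ler_pdivrMl//; apply: le_trans H.
by rewrite le_eqVlt; apply/orP; left; apply/eqP; field; exact: lt0r_neq0.
Unshelve. all: by end_near. Qed.

Lemma nderivable_flat_exp n p : nderivable n (flat_exp p).
Proof.
elim: n p => // n IH p; exists (flat_exp ('X ^+ 2 * (p - p^`()))); split => //.
exact: is_derive_flat_exp.
Qed.

Lemma flat_exp1_le0 (t : R) : t <= 0 -> flat_exp 1 t = 0.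
Proof. by move=> t0; rewrite /flat_exp ltNge t0. Qed.

Lemma flat_exp1_gt0 (t : R) : 0 < t -> 0 < flat_exp 1 t.
Proof. by move=> t0; rewrite /flat_exp t0 hornerC mul1r expR_gt0. Qed.

Lemma flat_exp1_le (s t : R) : s <= t -> flat_exp 1 s <= flat_exp 1 t.
Proof.
move=> st; rewrite /flat_exp !hornerC !mul1r; case: ifPn => s0; last first.
  by case: ifPn => // _; exact: expR_ge0.
by rewrite (lt_le_trans s0 st) ler_expR lerN2 lef_pV2// posrE (lt_le_trans s0).
Qed.

Lemma nderivable_derive1 n f : nderivable n.+1 f -> (forall t : R, is_derive t 1 f (f^`()%classic t)) /\ nderivable n f^`()%classic.
Proof.
move=> [f' [df Cf']].
have E : f^`()%classic = f' by apply/funext => t; rewrite derive1E; have [_] := df t.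
by rewrite E.
Qed.

Lemma nderivable_sequence f : (forall n, nderivable n f) ->
  exists U : nat -> R -> R, U 0%N = f /\ forall m (t : R), is_derive t 1 (U m) (U m.+1 t).
Proof.
move=> Cf; exists (fun m => iter m (fun g : R -> R => g^`()%classic) f); split => // m.
suff : forall n, nderivable n (iter m (fun g : R -> R => g^`()%classic) f).
  by move=> /(_ 1%N)/nderivable_derive1[].
by elim: m => // m IH n; have [] := nderivable_derive1 (IH n.+1).
Qed.

Lemma is_derive_cst_near (g : R -> R) (t l c : R) :
  (\forall s \near t, g s = c) -> is_derive t 1 g l -> l = 0.
Proof.
move=> gc dg; have [_ <-] := dg.
by rewrite (@near_eq_derive _ _ _ g (cst c))// derive_cst.
Qed.

(* With E(t) = exp(-1/t) for t > 0 and E(t) = 0 otherwise, the step is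
   E(E(1) - E(1 - t/r)) / E(E(1)); U m is its m-th derivative. *)
Lemma smooth_step_exists (r : R) : 0 < r -> exists U : nat -> R -> R,
  [/\ forall m (t : R), is_derive t 1 (U m) (U m.+1 t),
      forall t, t <= 0 -> U 0%N t = 0,
      forall t, r <= t -> U 0%N t = 1,
      forall m t, t < 0 \/ r < t -> U m.+1 t = 0 &
      forall m, exists C, forall t, `|U m t| <= C].
Proof.
move=> r0; pose a := flat_exp 1 1; pose c := flat_exp 1 a.
have a0 : 0 < a := flat_exp1_gt0 ltr01.
have c0 : 0 < c := flat_exp1_gt0 a0.
pose f t := c^-1 * flat_exp 1 (a + (-1) * flat_exp 1 (1 + (- r^-1) * t)).
have Cid n : nderivable n (fun t : R => t).
  case: n => // n; exists (cst 1); split; last exact: nderivable_cst.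
  by move=> t; exact: is_derive_id.
have Cf n : nderivable n f.
  apply: nderivableM; first exact: nderivable_cst.
  apply: (@nderivable_comp n (flat_exp 1)); first exact: nderivable_flat_exp.
  apply: nderivableD; first exact: nderivable_cst.
  apply: nderivableM; first exact: nderivable_cst.
  apply: (@nderivable_comp n (flat_exp 1)); first exact: nderivable_flat_exp.
  by apply: nderivableD; [exact: nderivable_cst|apply: nderivableM => //; exact: nderivable_cst].
have [U [U0 dU]] := nderivable_sequence Cf.
have f0 t : t <= 0 -> f t = 0.
  move=> t0; rewrite /f [flat_exp 1 (a + _)]flat_exp1_le0 ?mulr0// mulN1r subr_le0 flat_exp1_le//.
  by rewrite lerDl mulNr oppr_ge0 pmulr_rle0 ?invr_gt0.
have f1 t : r <= t -> f t = 1.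
  move=> rt; rewrite /f [flat_exp 1 (1 + _)]flat_exp1_le0 ?mulr0 ?addr0 ?mulVf ?gt_eqF//.
  by rewrite mulNr subr_le0 mulrC ler_pdivlMr// mul1r.
have Uout m t : t < 0 \/ r < t -> U m.+1 t = 0.
  elim: m t => [|m IH] t [t0|t0].
  - apply: (@is_derive_cst_near _ _ _ 0 _ (dU 0%N t)); near=> s.
    by rewrite U0 f0//; apply: ltW; near: s; exact: lt_nbhsl.
  - apply: (@is_derive_cst_near _ _ _ 1 _ (dU 0%N t)); near=> s.
    by rewrite U0 f1//; apply: ltW; near: s; exact: lt_nbhsr.
  - apply: (@is_derive_cst_near _ _ _ 0 _ (dU m.+1 t)); near=> s.
    by apply: IH; left; near: s; exact: lt_nbhsl.
  - apply: (@is_derive_cst_near _ _ _ 0 _ (dU m.+1 t)); near=> s.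
    by apply: IH; right; near: s; exact: lt_nbhsr.
exists U; split; rewrite ?U0// => m.
have cU : {within `[0, r], continuous (fun t => `|U m t|)}.
  apply: continuous_subspaceT => t; apply: continuous_comp; last exact: norm_continuous.
  by apply: differentiable_continuous; apply/derivable1_diffP; have [] := dU m t.
have [x _ Hx] := EVT_max (ltW r0) cU.
(* The maximum over [0, r] handles the transition; the added 1 covers m = 0 beyond r, where the step
   is 1. *)
exists (`|U m x| + 1) => t.
have [t0|t0] := ltP t 0.
  case: m Hx {cU} => [|m] Hx; last by rewrite Uout ?normr0 ?addr_ge0//; left.
  by rewrite U0 (f0 _ (ltW t0)) normr0 addr_ge0.
have [tr|tr] := ltP r t.
  case: m Hx {cU} => [|m] Hx; last by rewrite Uout ?normr0 ?addr_ge0//; right.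
  by rewrite U0 (f1 _ (ltW tr)) normr1 lerDr.
by rewrite (le_trans (Hx t _)) ?lerDl// in_itv/= t0 tr.
Unshelve. all: by end_near. Qed.

End smooth_step.

(** * Calculus on R^d *)

Section multivariate.
Variables (R : realType) (d : nat).
Local Notation Rd := 'rV[R]_d.
Implicit Types (s : seq 'I_d) (g : Rd -> R) (f : Rd -> R[i]).

Definition pd (i : 'I_d) g : Rd -> R := fun x => 'D_(delta_mx 0 i) g x.
Definition rD s g : Rd -> R := foldr pd g s.
Definition rsmooth g := forall s x, differentiable (rD s g) x.

Lemma Re_Dpart s f : (fun x => complex.Re (Dpart s f x)) = rD s (fun x => complex.Re (f x)).
Proof. by elim: s => //= i s <-. Qed.

Lemma Im_Dpart s f : (fun x => complex.Im (Dpart s f x)) = rD s (fun x => complex.Im (f x)).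
Proof. by elim: s => //= i s <-. Qed.

Lemma smoothP f : smooth f <->
  rsmooth (fun x => complex.Re (f x)) /\ rsmooth (fun x => complex.Im (f x)).
Proof.
split=> [sf|[sR sI] s x]; last by rewrite Re_Dpart Im_Dpart.
by split=> s x; [rewrite -Re_Dpart|rewrite -Im_Dpart]; have [] := sf s x.
Qed.

Lemma rD_cat s t g : rD (s ++ t) g = rD s (rD t g).
Proof. exact: foldr_cat. Qed.

Lemma pd_shift i g (a : Rd) : pd i (fun x => g (x + a)) = fun x => pd i g (x + a).
Proof.
apply/funext => x; rewrite /pd /derive.
suff -> : (fun h : R => h^-1 *: (((fun x => g (x + a)) \o shift x) (h *: delta_mx 0 i) - g (x + a))) =
  (fun h : R => h^-1 *: ((g \o shift (x + a)) (h *: delta_mx 0 i) - g (x + a))) by [].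
by apply/funext => h; rewrite /= addrA.
Qed.

Lemma rD_shift s g (a : Rd) : rD s (fun x => g (x + a)) = fun x => rD s g (x + a).
Proof. by elim: s => //= i s ->; rewrite pd_shift. Qed.

Lemma rsmooth_shift g (a : Rd) : rsmooth g -> rsmooth (fun x => g (x + a)).
Proof.
move=> sg s x; rewrite rD_shift.
apply: (@differentiable_comp _ _ _ _ (fun x : Rd => x + a) (rD s g)); last exact: sg.
by apply: differentiableD.
Qed.

Lemma is_derive_line g (x v : Rd) (t : R) : differentiable g (x + t *: v) ->
  is_derive t 1 (fun t => g (x + t *: v)) ('D_v g (x + t *: v)).
Proof.
move=> dg; have dv : derivable g (x + t *: v) v by exact: diff_derivable.
apply: is_derive_cvg.
suff -> : (fun h : R => h^-1 * (g (x + (h + t) *: v) - g (x + t *: v))) =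
  (fun h => h^-1 *: ((g \o shift (x + t *: v)) (h *: v) - g (x + t *: v))) by exact: dv.
by apply/funext => h; rewrite /= scalerDl addrCA.
Qed.

Lemma derive_sum_pd g (x v : Rd) : differentiable g x ->
  'D_v g x = \sum_i v 0 i * pd i g x.
Proof.
move=> dg; rewrite deriveE// [in LHS](row_sum_delta v) linear_sum /=.
by apply: eq_bigr => i _; rewrite linearZ /= /pd deriveE.
Qed.

(** Mean value theorem on the segment from y to x. It supplies the uniform modulus behind the
    continuity of convolution integrals. *)
Lemma rsmooth_lipschitz g : rsmooth g -> (forall i, exists M, forall x, `|pd i g x| <= M) ->
  exists L, forall x y, `|g x - g y| <= L * `|x - y|.
Proof.
move=> sg /choice[M HM]; exists (\sum_i `|M i|) => x y.
have dg z : differentiable g z := sg [::] z.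
pose h t := g (y + t *: (x - y)).
have dh (t : R) : is_derive t 1 h ('D_(x - y) g (y + t *: (x - y))) by exact: is_derive_line.
have ch : {within `[0, 1], continuous h}.
  by apply: derivable_within_continuous => t _; have [] := dh t.
have [c _] := MVT ltr01 (fun t _ => dh t) ch.
rewrite /h scale1r scale0r addr0 subrKC subr0 mulr1 => ->.
rewrite derive_sum_pd// mulr_suml; apply: le_trans (ler_norm_sum _ _ _) _.
apply: ler_sum => i _; rewrite normrM mulrC ler_pM//.
  by rewrite (le_trans (HM _ _))// ler_norm.
exact: row_norm_ge.
Qed.

Variable k : 'I_d.

(* The pairs (m, t) such that U m (x_k) * rD t g is a term, with multiplicity, of
   the Leibniz expansion of rD s (U 0 (x_k) * g). *)
Fixpoint leibniz s : seq (nat * seq 'I_d) :=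
  if s is i :: s' then
    flatten [seq (if i == k then [:: (p.1.+1, p.2)] else [::]) ++ [:: (p.1, i :: p.2)]
            | p <- leibniz s']
  else [:: (0%N, [::])].

Variable U : nat -> R -> R.
Hypothesis dU : forall m (t : R), is_derive t 1 (U m) (U m.+1 t).

Lemma differentiable_coordU m (x : Rd) : differentiable (fun x : Rd => U m (x 0 k)) x.
Proof.
apply: (@differentiable_comp _ _ _ _ (fun x : Rd => x 0 k) (U m)).
  exact: differentiable_coord.
by apply/derivable1_diffP; have [] := dU m (x 0 k).
Qed.

Lemma pd_coordU i m : pd i (fun x : Rd => U m (x 0 k)) = fun x => if i == k then U m.+1 (x 0 k) else 0.
Proof.
apply/funext => x; rewrite /pd; case: eqP => [->|/eqP ik].
  have [_ <-] := dU m (x 0 k); rewrite /derive.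
  suff -> : (fun h : R => h^-1 *: (((fun x : Rd => U m (x 0 k)) \o shift x) (h *: delta_mx 0 k) - U m (x 0 k))) =
    (fun h : R => h^-1 *: ((U m \o shift (x 0 k)) (h *: 1) - U m (x 0 k))) by [].
  by apply/funext => h; rewrite /= !mxE !eqxx.
rewrite /derive.
suff -> : (fun h : R => h^-1 *: (((fun x : Rd => U m (x 0 k)) \o shift x) (h *: delta_mx 0 i) - U m (x 0 k))) =
  cst 0 by exact: lim_cst.
by apply/funext => h; rewrite /= !mxE (eq_sym k) (negbTE ik) andbF mulr0 add0r subrr scaler0.
Qed.

Lemma pd_sum i (I : Type) (l : seq I) (h : I -> Rd -> R) x :
  (forall j x, differentiable (h j) x) ->
  pd i (fun x => \sum_(j <- l) h j x) x = \sum_(j <- l) pd i (h j) x /\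
  differentiable (fun x => \sum_(j <- l) h j x) x.
Proof.
move=> dh; elim: l x => [|j l IH] x.
  rewrite big_nil (_ : (fun _ => _) = cst 0); last by apply/funext => y; rewrite big_nil.
  by rewrite /pd derive_cst; split => //; exact: differentiable_cst.
have E : (fun x => \sum_(j <- j :: l) h j x) = h j + (fun x => \sum_(j <- l) h j x).
  by apply/funext => y; rewrite big_cons.
have [IH1 IH2] := IH x; rewrite E big_cons -IH1; split; last exact: differentiableD.
by rewrite /pd deriveD//; exact: diff_derivable.
Qed.

Lemma rD_cutoff s g : rsmooth g ->
  rD s (fun x => U 0 (x 0 k) * g x) = fun x => \sum_(p <- leibniz s) U p.1 (x 0 k) * rD p.2 g x.
Proof.
move=> sg; elim: s => [|i s IH] /=.
  by apply/funext => x; rewrite big_seq1.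
rewrite IH; apply/funext => x.
have dterm (p : nat * seq 'I_d) y : differentiable (fun x : Rd => U p.1 (x 0 k) * rD p.2 g x) y.
  by apply: differentiableM; [exact: differentiable_coordU|exact: sg].
have [-> _] := pd_sum i (leibniz s) x dterm.
rewrite big_flatten big_map; apply: eq_bigr => p _.
rewrite {1}/pd deriveM; last 2 first.
- by apply: diff_derivable; exact: differentiable_coordU.
- by apply: diff_derivable; exact: sg.
have := pd_coordU i p.1; rewrite /pd => /(congr1 (fun h => h x)) /= ->.
rewrite big_cat big_seq1 /=; case: eqP => _; rewrite ?big_seq1 ?big_nil /GRing.scale/=.
  by rewrite addrC; congr (_ + _); rewrite mulrC.
by rewrite mulr0 addr0 add0r.
Qed.

Lemma rsmooth_cutoff g : rsmooth g -> rsmooth (fun x => U 0 (x 0 k) * g x).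
Proof.
move=> sg s x; rewrite rD_cutoff//.
have dterm (p : nat * seq 'I_d) y : differentiable (fun x : Rd => U p.1 (x 0 k) * rD p.2 g x) y.
  by apply: differentiableM; [exact: differentiable_coordU|exact: sg].
by have [] := pd_sum k (leibniz s) x dterm.
Qed.

End multivariate.

(** * Schwartz functions and tempered distributions *)

Section schwartz_space.
Variables (R : realType) (d : nat).
Local Notation Rd := 'rV[R]_d.
Local Notation C := R[i].
Local Notation Re := complex.Re.
Local Notation Im := complex.Im.
Implicit Types (s : seq 'I_d) (g : Rd -> R) (phi psi : Rd -> C).

Lemma Re_cabs (z : C) : `|Re z| <= cabs z.
Proof.
case: z => a b; rewrite /cabs /= -sqrtr_sqr ler_sqrt ?lerDl ?sqr_ge0//.
by rewrite addr_ge0 ?sqr_ge0.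
Qed.

Lemma Im_cabs (z : C) : `|Im z| <= cabs z.
Proof.
case: z => a b; rewrite /cabs /= -sqrtr_sqr ler_sqrt ?lerDr ?sqr_ge0//.
by rewrite addr_ge0 ?sqr_ge0.
Qed.

Lemma cabs_le (z : C) : cabs z <= `|Re z| + `|Im z|.
Proof.
case: z => a b; rewrite /cabs /=.
rewrite -[leRHS]ger0_norm ?addr_ge0// -sqrtr_sqr ler_sqrt ?sqr_ge0//.
rewrite -[a ^+ 2]real_normK ?num_real// -[b ^+ 2]real_normK ?num_real//.
have := normr_ge0 a; have := normr_ge0 b; nra.
Qed.

Lemma cabs_ge0 (z : C) : 0 <= cabs z.
Proof. by apply: le_trans (Re_cabs z). Qed.

Lemma cabs_eq0 (z : C) : cabs z <= 0 -> z = 0.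
Proof.
move=> z0; have := le_trans (Re_cabs z) z0; have := le_trans (Im_cabs z) z0.
by case: z {z0} => a b /=; rewrite !normr_le0 => /eqP -> /eqP ->.
Qed.

Lemma complex_ReD (z w : C) : Re (z + w) = Re z + Re w. Proof. by case: z w => [a b] [? ?]. Qed.
Lemma complex_ImD (z w : C) : Im (z + w) = Im z + Im w. Proof. by case: z w => [a b] [? ?]. Qed.
Lemma complex_ReM (z w : C) : Re (z * w) = Re z * Re w - Im z * Im w. Proof. by case: z w => [a b] [? ?]. Qed.
Lemma complex_ImM (z w : C) : Im (z * w) = Re z * Im w + Im z * Re w. Proof. by case: z w => [a b] [? ?]. Qed.

Lemma Re_sum (I : Type) (r : seq I) (z : I -> C) : Re (\sum_(j <- r) z j) = \sum_(j <- r) Re (z j).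
Proof. by elim: r => [|j r IH]; rewrite ?big_nil ?big_cons ?complex_ReD ?IH. Qed.
Lemma Im_sum (I : Type) (r : seq I) (z : I -> C) : Im (\sum_(j <- r) z j) = \sum_(j <- r) Im (z j).
Proof. by elim: r => [|j r IH]; rewrite ?big_nil ?big_cons ?complex_ImD ?IH. Qed.

Lemma Re_sign n (z : C) : Re ((-1) ^+ n * z) = (-1) ^+ n * Re z.
Proof.
elim: n => [|n IH]; first by rewrite !expr0 !mul1r.
by rewrite !exprS !mulN1r !mulNr -IH; case: (_ * z).
Qed.
Lemma Im_sign n (z : C) : Im ((-1) ^+ n * z) = (-1) ^+ n * Im z.
Proof.
elim: n => [|n IH]; first by rewrite !expr0 !mul1r.
by rewrite !exprS !mulN1r !mulNr -IH; case: (_ * z).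
Qed.

Lemma jbracket_sqr (x : Rd) : jbracket x ^+ 2 = 1 + qd x.
Proof.
have q0 : 0 <= qd x := qd_ge0 x.
rewrite /jbracket /enorm -/(qd x) sqr_sqrtr; last by rewrite addr_ge0 ?sqr_ge0.
by rewrite sqr_sqrtr.
Qed.

Lemma jbracket_ge1 (x : Rd) : 1 <= jbracket x.
Proof. by rewrite -(@expr_ge1 _ 2)// ?sqrtr_ge0// jbracket_sqr lerDl qd_ge0. Qed.

Lemma jbracket_gt0 (x : Rd) : 0 < jbracket x.
Proof. exact: lt_le_trans ltr01 (jbracket_ge1 x). Qed.

Lemma coord_jbracket (x : Rd) i : `|x 0 i| <= jbracket x.
Proof.
have j0 := jbracket_gt0 x.
rewrite -(@ler_pXn2r _ 2) ?nnegrE ?(ltW j0)// jbracket_sqr real_normK ?num_real//.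
rewrite /qd (bigD1 i)//= addrCA lerDl addr_ge0//.
by apply: sumr_ge0 => l _; exact: sqr_ge0.
Qed.

(** A form of Peetre's inequality; it transfers polynomial weights between x, y and x + y. *)
Lemma jbracketD (x y : Rd) : jbracket (x + y) <= 2 * jbracket x * jbracket y.
Proof.
have jx := jbracket_gt0 x; have jy := jbracket_gt0 y.
rewrite -(@ler_pXn2r _ 2) ?nnegrE ?(ltW (jbracket_gt0 _)) ?mulr_ge0 ?(ltW jx) ?(ltW jy)//.
rewrite !exprMn !jbracket_sqr.
have := qdD_le x y; have := qd_ge0 x; have := qd_ge0 y; nra.
Qed.

Lemma jbracketN (x : Rd) : jbracket (- x) = jbracket x.
Proof.
congr Num.sqrt; congr (1 + Num.sqrt _ ^+ 2); apply: eq_bigr => i _.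
by rewrite mxE sqrrN.
Qed.

Definition rschwartz g := rsmooth g /\ forall (k : nat) s,
  exists M : R, forall x, jbracket x ^+ k * `|rD s g x| <= M.

Lemma schwartzP phi : schwartz phi <->
  rschwartz (fun x => Re (phi x)) /\ rschwartz (fun x => Im (phi x)).
Proof.
split=> [[/smoothP[sR sI] b]|[[sR bR] [sI bI]]].
  split; split=> // k s; have [M HM] := b k s; exists M => x.
    apply: le_trans (HM x); rewrite ler_wpM2l ?exprn_ge0 ?(ltW (jbracket_gt0 x))//.
    by rewrite -Re_Dpart Re_cabs.
  apply: le_trans (HM x); rewrite ler_wpM2l ?exprn_ge0 ?(ltW (jbracket_gt0 x))//.
  by rewrite -Im_Dpart Im_cabs.
split; first exact/smoothP.
move=> k s; have [M HM] := bR k s; have [N HN] := bI k s; exists (M + N) => x.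
apply: le_trans (lerD (HM x) (HN x)).
rewrite -mulrDr ler_wpM2l ?exprn_ge0 ?(ltW (jbracket_gt0 x))//.
by rewrite -Re_Dpart -Im_Dpart cabs_le.
Qed.

Lemma rschwartz_shift g (a : Rd) : rschwartz g -> rschwartz (fun x => g (x + a)).
Proof.
move=> [sg bg]; split; first exact: rsmooth_shift.
move=> k s; have [M HM] := bg k s; exists ((2 * jbracket a) ^+ k * M) => x.
rewrite rD_shift.
apply: le_trans (_ : (2 * jbracket (x + a) * jbracket a) ^+ k * `|rD s g (x + a)| <= _).
  rewrite ler_wpM2r// lerXn2r ?nnegrE ?(ltW (jbracket_gt0 _))//.
    by rewrite !mulr_ge0// ltW// jbracket_gt0.
  by have := jbracketD (x + a) (- a); rewrite addrK jbracketN.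
rewrite [2 * _ * _]mulrAC exprMn -mulrA; apply: ler_wpM2l; last exact: HM.
by rewrite exprn_ge0// mulr_ge0// ltW// jbracket_gt0.
Qed.

Lemma schwartz_shift phi (a : Rd) : schwartz phi -> schwartz (fun y => phi (a + y)).
Proof.
move=> /schwartzP[sR sI]; apply/schwartzP.
split; [have := rschwartz_shift a sR|have := rschwartz_shift a sI];
  by congr rschwartz; apply/funext => x; rewrite addrC.
Qed.

(** Replaces the supremum in the seminorm by an arbitrary pointwise bound B, which also shows that
    the supremum is over a bounded set. The constant of [tempered] may be negative, hence its
    absolute value. *)
Lemma tempered_bound (T : functional R d) : tempered T ->
  exists (N : nat) (K : R), 0 <= K /\ forall phi, schwartz phi -> forall B,
    (forall s x, (size s <= N)%N -> jbracket x ^+ N * cabs (Dpart s phi x) <= B) ->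
    cabs (T phi) <= K * B.
Proof.
move=> [_ [N [M HM]]]; exists N, `|M|; split => // phi sphi B HB.
set E := [set r | exists (s : seq 'I_d) (x : Rd),
    (size s <= N)%N /\ r = jbracket x ^+ N * cabs (Dpart s phi x)].
have E0 : E (jbracket (0 : Rd) ^+ N * cabs (Dpart [::] phi 0)) by exists [::], 0.
have EB : ubound E B by move=> _ [s [x [sN ->]]]; exact: HB.
have sB : schwartz_seminorm N phi <= B by apply: ge_sup => //; exists (jbracket (0 : Rd) ^+ N * cabs (Dpart [::] phi 0)).
have s0 : 0 <= schwartz_seminorm N phi.
  apply: le_trans (ub_le_sup _ E0); last by exists B.
  by rewrite mulr_ge0 ?cabs_ge0// exprn_ge0// ltW// jbracket_gt0.
apply: le_trans (HM _ sphi) _.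
apply: le_trans (_ : `|M| * schwartz_seminorm N phi <= _); last by rewrite ler_wpM2l.
by rewrite ler_wpM2r// ler_norm.
Qed.

(** Only finitely many multi-indices have order at most N, so bounds found for each can be added up;
    the induction splits off the outermost coordinate. *)
Lemma uniform_order_bound (Q : seq 'I_d -> R -> Prop) N :
  (forall s B B', B <= B' -> Q s B -> Q s B') -> (forall s, exists B, Q s B) ->
  exists B, forall s, (size s <= N)%N -> Q s B.
Proof.
elim: N Q => [|N IH] Q mono ex.
  by have [B QB] := ex [::]; exists B => -[|].
have /choice[b Hb] i : exists B, forall s, (size s <= N)%N -> Q (i :: s) B.
  by apply: (IH (fun s => Q (i :: s))) => [s B B'|s]; [exact: mono|exact: ex].
have [B QB] := ex [::]; exists (`|B| + \sum_i `|b i|) => -[_|i s sN].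
  by apply: mono QB; rewrite (le_trans (ler_norm _))// lerDl sumr_ge0.
apply: mono (Hb i s sN); rewrite (bigD1 i)//= addrCA (le_trans (ler_norm _))// lerDl addr_ge0//.
by rewrite sumr_ge0.
Qed.

End schwartz_space.

(** * Continuity and decay of x -> f(phi(x + .)) *)

Section convolution.
Variables (R : realType) (d : nat).
Local Notation Rd := 'rV[R]_d.
Local Notation C := R[i].
Local Notation Re := complex.Re.
Local Notation Im := complex.Im.
Implicit Types (s : seq 'I_d) (g : Rd -> R) (phi psi : Rd -> C).

Lemma eq_lerW (a b : R) : a = b -> a <= b.
Proof. by move->. Qed.

Lemma prod_jbracket (x : Rd) : \prod_i oneDsqr (x 0 i) <= jbracket x ^+ (2 * d).
Proof.
rewrite exprM (_ : _ ^+ d = \prod_(i < d) jbracket x ^+ 2); last by rewrite prodr_const card_ord.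
apply: ler_prod => i _.
rewrite (le_trans ler01 (oneDsqr_ge1 _))/= jbracket_sqr /oneDsqr lerD2l /qd (bigD1 i)//= lerDl.
by apply: sumr_ge0 => l _; exact: sqr_ge0.
Qed.

Lemma jbracket_oneDsqrs (x : Rd) (r : R) : 0 <= r -> (jbracket x ^+ (2 * d))^-1 * r <= oneDsqrs x * r.
Proof.
move=> r0; rewrite ler_wpM2r// /oneDsqrs prodfV lef_pV2 ?posrE.
- exact: prod_jbracket.
- by rewrite exprn_gt0// jbracket_gt0.
- by apply: prodr_gt0 => i _; rewrite (lt_le_trans ltr01 (oneDsqr_ge1 _)).
Qed.

(** Implies what the uniqueness result asks of its function, in a form stable under linear
    combinations. *)
Definition decaying g := continuous g /\ exists M, forall x, `|g x| <= M * oneDsqrs x.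

Lemma decayingD g h : decaying g -> decaying h -> decaying (fun x => g x + h x).
Proof.
move=> [cg [M HM]] [ch [N HN]]; split.
  by move=> x; apply: continuousD; [exact: cg|exact: ch].
exists (M + N) => x; rewrite mulrDl.
by apply: le_trans (ler_normD _ _) _; exact: lerD.
Qed.

Lemma decayingZ (c : R) g : decaying g -> decaying (fun x => c * g x).
Proof.
move=> [cg [M HM]]; split.
  by move=> x; apply: continuousM; [exact: cst_continuous|exact: cg].
by exists (`|c| * M) => x; rewrite normrM -mulrA ler_wpM2l.
Qed.

Lemma decaying_sum (I : Type) (l : seq I) (g : I -> Rd -> R) :
  (forall i, decaying (g i)) -> decaying (fun x => \sum_(i <- l) g i x).
Proof.
move=> Dg; elim: l => [|i l IH].
  rewrite (_ : (fun _ => _) = fun=> 0); last by apply/funext => x; rewrite big_nil.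
  by split; [exact: cst_continuous|exists 0 => x; rewrite normr0 mul0r].
rewrite (_ : (fun _ => _) = fun x => g i x + \sum_(i <- l) g i x); last first.
  by apply/funext => x; rewrite big_cons.
exact: decayingD.
Qed.

Lemma decaying_integrable g : decaying g -> rintegrable g.
Proof.
move=> [cg [M HM]]; apply: rintegrable_le HM (rintegrableZ M (@rintegrable_oneDsqrs R d)).
exact: continuous_rmeas.
Qed.

Lemma rschwartz_bounded g s : rschwartz g -> exists M, forall x, `|rD s g x| <= M.
Proof.
by move=> [_ bg]; have [M HM] := bg 0%N s; exists M => x; have := HM x; rewrite mul1r.
Qed.

Lemma rschwartz_rD g s : rschwartz g -> rschwartz (rD s g).
Proof.
move=> [sg bg]; split=> [t x|k t]; rewrite -rD_cat; [exact: sg|exact: bg].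
Qed.

Lemma rschwartz_continuous g : rschwartz g -> continuous g.
Proof. by move=> [sg _] x; apply: differentiable_continuous; exact: (sg [::]). Qed.

(** With k = 2d, a weight of order k dominates the product of the 1 + x_i^2. Of the weight 2k = 4d
    on p, one half pays for Peetre's inequality, which turns the decay of g in x + y into decay in
    x; the other half remains for integrability in y. *)
Lemma conv_pointwise (p g : Rd -> R) (M N : R) (x y : Rd) :
  (jbracket y ^+ (4 * d) * `|p y| <= M) ->
  (jbracket (x + y) ^+ (2 * d) * `|g (x + y)| <= N) ->
  `|p y * g (x + y)| <= 2 ^+ (2 * d) * M * N * oneDsqrs x * oneDsqrs y.
Proof.
set k := (2 * d)%N; have -> : (4 * d = k + k)%N by rewrite /k -mulnDl.
have jx := jbracket_gt0 x; have jy := jbracket_gt0 y; have jxy := jbracket_gt0 (x + y).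
move=> HM HN.
have J : jbracket x ^+ k <= 2 ^+ k * jbracket (x + y) ^+ k * jbracket y ^+ k.
  rewrite -!exprMn; apply: lerXn2r; [by rewrite nnegrE ltW|by rewrite nnegrE !mulr_ge0// ltW|].
  by have := jbracketD (x + y) (- y); rewrite addrK jbracketN.
have M0 : 0 <= M by apply: le_trans HM; rewrite mulr_ge0// exprn_ge0// ltW.
have N0 : 0 <= N by apply: le_trans HN; rewrite mulr_ge0// exprn_ge0// ltW.
have jxk : 0 < jbracket x ^+ k by rewrite exprn_gt0.
have jyk : 0 < jbracket y ^+ k by rewrite exprn_gt0.
have B0 : 0 <= 2 ^+ k * M * N by rewrite !mulr_ge0// exprn_ge0.
suff H : `|p y * g (x + y)| <= (jbracket x ^+ k)^-1 * ((jbracket y ^+ k)^-1 * (2 ^+ k * M * N)).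
  apply: le_trans H _.
  rewrite (_ : _ * oneDsqrs y = oneDsqrs x * (oneDsqrs y * (2 ^+ k * M * N))); last by ring.
  apply: le_trans (jbracket_oneDsqrs x _) _; first by rewrite mulr_ge0// invr_ge0 ltW.
  by rewrite ler_wpM2l ?oneDsqrs_ge0// jbracket_oneDsqrs.
rewrite ler_pdivlMl// ler_pdivlMl// normrM.
rewrite exprD in HM.
have HMN := ler_pM (mulr_ge0 (ltW (mulr_gt0 jyk jyk)) (normr_ge0 _)) (mulr_ge0 (exprn_ge0 k (ltW jxy)) (normr_ge0 _)) HM HN.
apply: le_trans (_ : 2 ^+ k * (jbracket y ^+ k * jbracket y ^+ k * `|p y| *
  (jbracket (x + y) ^+ k * `|g (x + y)|)) <= _); last first.
  by rewrite -[leRHS]mulrA ler_wpM2l// exprn_ge0.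
set t := `|p y|; set u := `|g _|.
have tu : 0 <= t * u by rewrite mulr_ge0 ?normr_ge0.
apply: le_trans (_ : jbracket y ^+ k * ((2 ^+ k * jbracket (x + y) ^+ k * jbracket y ^+ k) * (t * u)) <= _).
  by rewrite ler_pM2l// ler_wpM2r.
by apply: eq_lerW; ring.
Qed.

(** Decay is the pointwise bound integrated in y; continuity holds because g is Lipschitz and p
    integrable. *)
Lemma decaying_conv (p g : Rd -> R) : continuous p ->
  (exists M, forall y, jbracket y ^+ (4 * d) * `|p y| <= M) -> rschwartz g ->
  decaying (fun x => rint (fun y => p y * g (x + y))) /\
  forall x, rintegrable (fun y => p y * g (x + y)).
Proof.
move=> cp [M HM] sg; have [_ bg] := sg; have [N HN] := bg (2 * d)%N [::].
have cg := rschwartz_continuous sg.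
have pw x y := conv_pointwise (HM y) (HN (x + y)).
have cpg x : continuous (fun y => p y * g (x + y)).
  move=> y; apply: continuousM; first exact: cp.
  apply: continuous_comp; last exact: cg.
  by apply: continuousD; [exact: cst_continuous|exact: cvg_id].
have Ipg x : rintegrable (fun y => p y * g (x + y)).
  apply: rintegrable_le (pw x) (rintegrableZ _ (@rintegrable_oneDsqrs R d)).
  exact: continuous_rmeas.
split=> //; split; last first.
  exists (2 ^+ (2 * d) * M * N * rint (@oneDsqrs R d)) => x.
  apply: le_trans (norm_rint (Ipg x)) _.
  apply: le_trans (le_rint (rintegrable_norm (Ipg x)) (rintegrableZ _ (@rintegrable_oneDsqrs R d)) (pw x)) _.
  by rewrite rintZ ?mulrA; [apply: eq_lerW; ring|exact: rintegrable_oneDsqrs].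
have Ip : rintegrable p.
  apply: (@rintegrable_le _ _ _ (fun y => M * oneDsqrs y)); first exact: continuous_rmeas.
    move=> y.
    have M0 : 0 <= M by apply: le_trans (HM y); rewrite mulr_ge0// exprn_ge0// ltW// jbracket_gt0.
    rewrite mulrC; apply: le_trans (jbracket_oneDsqrs y M0).
    rewrite ler_pdivlMl ?exprn_gt0 ?jbracket_gt0//; apply: le_trans (HM y).
    by rewrite ler_wpM2r// ler_weXn2l ?jbracket_ge1// leq_mul2r orbT.
  by apply: rintegrableZ; exact: rintegrable_oneDsqrs.
have [L HL] : exists L, forall x y, `|g x - g y| <= L * `|x - y|.
  by apply: rsmooth_lipschitz; [exact: sg.1|move=> i; exact: (rschwartz_bounded [:: i] sg)].
suff H (x : Rd) : rint (fun y => p y * g (z + y)) @[z --> x] --> rint (fun y => p y * g (x + y)).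
  by move=> x; exact: H.
apply/(@cvgrPdist_le _ _ _ (nbhs x) (nbhs_filter x)) => e e0.
pose K := `|L| * rint (fun y => `|p y|) + 1.
have K0 : 0 < K by rewrite ltr_wpDl// mulr_ge0// Rintegral_ge0.
have eK : 0 < e / K by rewrite divr_gt0.
have Nx : \forall z \near x, `|x - z| <= e / K.
  by apply/nbhs_ballP; exists (e / K) => //= z; rewrite -ball_normE /= => /ltW.
near=> z; have xz : `|x - z| <= e / K by near: z.
have E : rint (fun y => p y * g (x + y)) - rint (fun y => p y * g (z + y)) =
    rint (fun y => p y * g (x + y) + (-1) * (p y * g (z + y))).
  by rewrite rintD ?rintZ ?mulN1r//; exact: rintegrableZ.
have ID : rintegrable (fun y => p y * g (x + y) + (-1) * (p y * g (z + y))).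
  by apply: rintegrableD => //; exact: rintegrableZ.
rewrite E; apply: le_trans (norm_rint ID) _.
have IL : rintegrable (fun y => (`|L| * (e / K)) * `|p y|).
  by apply: rintegrableZ; exact: rintegrable_norm.
apply: le_trans (le_rint (rintegrable_norm ID) IL _) _.
  move=> y; rewrite mulN1r -mulrBr normrM mulrC ler_wpM2r//.
  apply: le_trans (HL _ _) _; rewrite opprD addrACA subrr addr0.
  by apply: le_trans (ler_wpM2r (normr_ge0 _) (ler_norm L)) _; rewrite ler_wpM2l.
rewrite rintZ; last exact: rintegrable_norm.
rewrite mulrAC mulrA ler_pdivrMr// mulrC ler_pM2l//.
by rewrite /K lerDl.
Unshelve. all: by end_near. Qed.

Lemma Dpart_shift s phi (a : Rd) :
  Dpart s (fun y => phi (a + y)) = fun y => Dpart s phi (a + y).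
Proof.
elim: s => //= i s ->; apply/funext => y; rewrite /partial.
have E (h : Rd -> R) : 'D_(delta_mx 0 i) (fun y => h (a + y)) y = 'D_(delta_mx 0 i) h (a + y).
  have := congr1 (fun u => u y) (pd_shift i h a); rewrite /pd addrC => <-.
  by congr ('D_ _ _ _); apply/funext => z; rewrite addrC.
by congr Complex; [exact: (E (fun y => Re (Dpart s phi y)))|exact: (E (fun y => Im (Dpart s phi y)))].
Qed.

Lemma rintB g h : rintegrable g -> rintegrable h ->
  rint (fun x => g x - h x) = rint g + (-1) * rint h.
Proof.
move=> Ig Ih; rewrite -rintZ// -rintD//; last exact: rintegrableZ.
by congr rint; apply/funext => x; rewrite mulN1r.
Qed.

(** Rapid decrease enters here, at order 4d: the function is a finite signed sum of integrals of
    g_j(y) against derivatives of phi at x + y, and each real product is covered by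
    [decaying_conv]. *)
Lemma decaying_translates (f : functional R d) phi : rapidly_decreasing f -> schwartz phi ->
  decaying (fun x => Re (f (fun y => phi (x + y)))) /\
  decaying (fun x => Im (f (fun y => phi (x + y)))).
Proof.
move=> [_ /(_ (4 * d)%N)[n [b [g [Hg fE]]]]] sphi.
pose psi j := Dpart (b j) phi.
have E x : f (fun y => phi (x + y)) =
    \sum_j (-1) ^+ size (b j) * integral_Rd (fun y => g j y * psi j (x + y)).
  rewrite fE; last exact: schwartz_shift.
  by apply: eq_bigr => j _; rewrite /distr_deriv /of_fun Dpart_shift.
have [sR sI] := (schwartzP phi).1 sphi.
have spR j : rschwartz (fun y => Re (psi j y)).
  by rewrite /psi Re_Dpart; exact: rschwartz_rD.
have spI j : rschwartz (fun y => Im (psi j y)).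
  by rewrite /psi Im_Dpart; exact: rschwartz_rD.
have cR j : continuous (fun y => Re (g j y)) by have [[]] := Hg j.
have cI j : continuous (fun y => Im (g j y)) by have [[]] := Hg j.
have bR j : exists M, forall y, jbracket y ^+ (4 * d) * `|Re (g j y)| <= M.
  have [_ [M HM]] := Hg j; exists M => y; apply: le_trans (HM y).
  by rewrite ler_wpM2l ?Re_cabs// exprn_ge0// ltW// jbracket_gt0.
have bI j : exists M, forall y, jbracket y ^+ (4 * d) * `|Im (g j y)| <= M.
  have [_ [M HM]] := Hg j; exists M => y; apply: le_trans (HM y).
  by rewrite ler_wpM2l ?Im_cabs// exprn_ge0// ltW// jbracket_gt0.
split.
- rewrite (_ : (fun _ => _) = fun x => \sum_j (-1) ^+ size (b j) *
    (rint (fun y => Re (g j y) * Re (psi j (x + y))) + (-1) * rint (fun y => Im (g j y) * Im (psi j (x + y))))).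
    apply: decaying_sum => j; apply: decayingZ; apply: decayingD; last apply: decayingZ.
      exact: (decaying_conv (cR j) (bR j) (spR j)).1.
    exact: (decaying_conv (cI j) (bI j) (spI j)).1.
  apply/funext => x; rewrite E Re_sum; apply: eq_bigr => j _; rewrite Re_sign -rintB.
  + congr (_ * _); rewrite /= -[LHS]/(rint (fun y => Re (g j y * psi j (x + y)))).
    by congr rint; apply/funext => y; exact: complex_ReM.
  + exact: (decaying_conv (cR j) (bR j) (spR j)).2.
  + exact: (decaying_conv (cI j) (bI j) (spI j)).2.
rewrite (_ : (fun _ => _) = fun x => \sum_j (-1) ^+ size (b j) *
    (rint (fun y => Re (g j y) * Im (psi j (x + y))) + rint (fun y => Im (g j y) * Re (psi j (x + y))))).
  apply: decaying_sum => j; apply: decayingZ; apply: decayingD.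
    exact: (decaying_conv (cR j) (bR j) (spI j)).1.
  exact: (decaying_conv (cI j) (bI j) (spR j)).1.
apply/funext => x; rewrite E Im_sum; apply: eq_bigr => j _; rewrite Im_sign -rintD.
+ congr (_ * _); rewrite /= -[LHS]/(rint (fun y => Im (g j y * psi j (x + y)))).
  by congr rint; apply/funext => y; exact: complex_ImM.
+ exact: (decaying_conv (cR j) (bR j) (spI j)).2.
+ exact: (decaying_conv (cI j) (bI j) (spR j)).2.
Qed.

End convolution.

(** * Estimates for cutoffs in one coordinate *)

Section cutoffs.
Variables (R : realType) (d : nat).
Local Notation Rd := 'rV[R]_d.
Local Notation C := R[i].
Local Notation Re := complex.Re.
Local Notation Im := complex.Im.
Implicit Types (s : seq 'I_d) (g : Rd -> R) (phi psi : Rd -> C).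

Lemma sum_bound (I : Type) (l : seq I) (h : I -> Rd -> R) :
  (forall i, exists B, forall x, h i x <= B) -> exists B, forall x, \sum_(i <- l) h i x <= B.
Proof.
move=> hb; elim: l => [|i l [B HB]]; first by exists 0 => x; rewrite big_nil.
by have [b Hb] := hb i; exists (b + B) => x; rewrite big_cons lerD.
Qed.

Variable k : 'I_d.

(** The point is uniformity: B is chosen before W and w. The factor w costs at most one power of the
    bracket, absorbed by the order N + 1 decay of g in each Leibniz term. It is used with w = 1 for
    a bounded cutoff, and with w large for one that vanishes on |t| < w. *)
Lemma cutoff_bound (c : nat -> R) g N s : rschwartz g -> exists B,
  forall W : nat -> R -> R, (forall m (t : R), is_derive t 1 (W m) (W m.+1 t)) ->
  forall w, 0 <= w -> (forall m (x : Rd), w * `|W m (x 0 k)| <= c m * jbracket x) ->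
  forall x, w * (jbracket x ^+ N * `|rD s (fun x => W 0%N (x 0 k) * g x) x|) <= B.
Proof.
move=> [sg bg].
have [B HB] : exists B, forall x, \sum_(p <- leibniz k s)
    `|c p.1| * (jbracket x ^+ N.+1 * `|rD p.2 g x|) <= B.
  apply: (@sum_bound _ _ (fun p x => `|c p.1| * (jbracket x ^+ N.+1 * `|rD p.2 g x|))) => p.
  have [M HM] := bg N.+1 p.2; exists (`|c p.1| * M) => x.
  by rewrite ler_wpM2l.
exists B => W dW w w0 Hw x; apply: le_trans (HB x).
rewrite (rD_cutoff k dW s sg) mulrA.
have j0 := jbracket_gt0 x.
apply: le_trans (ler_wpM2l _ (ler_norm_sum _ _ _)) _.
  by rewrite mulr_ge0// exprn_ge0// ltW.
rewrite mulr_sumr; apply: ler_sum => p _; rewrite normrM.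
rewrite [leLHS](_ : _ = (w * `|W p.1 (x 0 k)|) * (jbracket x ^+ N * `|rD p.2 g x|)); last by rewrite /=; ring.
rewrite (_ : `|c p.1| * _ = (`|c p.1| * jbracket x) * (jbracket x ^+ N * `|rD p.2 g x|)); last first.
  by rewrite exprS; ring.
rewrite ler_wpM2r//; first by rewrite mulr_ge0// exprn_ge0// ltW.
by apply: le_trans (Hw _ _) _; rewrite ler_wpM2r ?ler_norm// ltW.
Qed.

Definition cut (u : R -> R) psi : Rd -> C := fun x => (u (x 0 k))%:C%C * psi x.

Lemma Re_cut u psi : (fun x => Re (cut u psi x)) = fun x => u (x 0 k) * Re (psi x).
Proof. by apply/funext => x; rewrite /cut complex_ReM /= mul0r subr0. Qed.

Lemma Im_cut u psi : (fun x => Im (cut u psi x)) = fun x => u (x 0 k) * Im (psi x).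
Proof. by apply/funext => x; rewrite /cut complex_ImM /= mul0r addr0. Qed.

(* W m stands for the m-th derivative of W 0. *)
Definition bounded_tower (W : nat -> R -> R) :=
  (forall m (t : R), is_derive t 1 (W m) (W m.+1 t)) /\
  (forall m, exists c, forall t, `|W m t| <= c).

Lemma schwartz_cut W psi : bounded_tower W -> schwartz psi -> schwartz (cut (W 0%N) psi).
Proof.
move=> [dW /choice[c Hc]] /schwartzP[sR sI]; apply/schwartzP; rewrite Re_cut Im_cut.
have H m (x : Rd) : 1 * `|W m (x 0 k)| <= c m * jbracket x.
  rewrite mul1r; apply: le_trans (Hc m _) _; rewrite ler_peMr ?jbracket_ge1//.
  exact: le_trans (Hc m 0).
have key g : rschwartz g -> rschwartz (fun x => W 0%N (x 0 k) * g x).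
  move=> sg; split; first exact: (rsmooth_cutoff k dW sg.1).
  move=> N s; have [B HB] := cutoff_bound c N s sg; exists B => x.
  by have := HB W dW 1 ler01 H x; rewrite mul1r.
by split; exact: key.
Qed.

Lemma bounded_tower_shift W (a : R) : bounded_tower W -> bounded_tower (fun m t => W m (t + a)).
Proof.
move=> [dW bW]; split=> m; last by have [c Hc] := bW m; exists c.
move=> t; have da : is_derive t 1 (fun t : R => t + a) 1.
  by have := is_deriveD (is_derive_id t 1) (is_derive_cst a t 1); rewrite addr0.
by have := @is_derive1_comp _ (W m) (fun t : R => t + a) t _ _ (dW m (t + a)) da; rewrite mulr1.
Qed.

Lemma bounded_towerB W1 W2 : bounded_tower W1 -> bounded_tower W2 ->
  bounded_tower (fun m t => W1 m t - W2 m t).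
Proof.
move=> [d1 b1] [d2 b2]; split=> m; last first.
  have [c1 H1] := b1 m; have [c2 H2] := b2 m; exists (c1 + c2) => t.
  by rewrite (le_trans (ler_normB _ _))// lerD.
by move=> t; exact: (is_deriveB (d1 m t) (d2 m t)).
Qed.

Lemma bounded_tower1 : bounded_tower (fun m _ => (m == 0%N)%:R).
Proof.
split=> m; first by move=> t; exact: is_derive_cst.
by exists 1 => t; case: m => [|m] /=; rewrite ?normr1 ?normr0.
Qed.

(** Where the cutoff is nonzero, w <= |x_k| <= <x>, so the factor w is absorbed by the decay of psi.
    The value of f is thus O(1/w), uniformly over cutoffs with the same derivative bounds. *)
Lemma cutoff_decay (f : functional R d) psi (c : nat -> R) : tempered f -> schwartz psi ->
  exists B, forall (W : nat -> R -> R) (w : R), bounded_tower W -> 0 < w ->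
    (forall m t, `|W m t| <= c m) -> (forall m t, `|t| < w -> W m t = 0) ->
    w * cabs (f (cut (W 0%N) psi)) <= B.
Proof.
move=> tf spsi; have [N [K [K0 HK]]] := tempered_bound tf.
have [sR sI] := (schwartzP psi).1 spsi.
pose Q s B := forall (W : nat -> R -> R) (w : R),
    bounded_tower W -> 0 <= w ->
    (forall m t, `|W m t| <= c m) -> (forall m t, `|t| < w -> W m t = 0) ->
    forall x, w * (jbracket x ^+ N * cabs (Dpart s (cut (W 0%N) psi) x)) <= B.
have [|s|B HB] := @uniform_order_bound R d Q N.
- by move=> s B B' BB' H W w bW w0 Wc Ww x; exact: le_trans (H W w bW w0 Wc Ww x) BB'.
- have [B1 HB1] := cutoff_bound c N s sR; have [B2 HB2] := cutoff_bound c N s sI.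
  exists (B1 + B2) => W w [dW bW] w0 Wc Ww x.
  have H m (y : Rd) : w * `|W m (y 0 k)| <= c m * jbracket y.
    have c0 : 0 <= c m by apply: le_trans (Wc m 0).
    have [yw|yw] := ltP `|y 0 k| w.
      by rewrite Ww// normr0 mulr0 mulr_ge0// ltW// jbracket_gt0.
    by rewrite mulrC ler_pM// (le_trans yw)// coord_jbracket.
  apply: le_trans (lerD (HB1 W dW w w0 H x) (HB2 W dW w w0 H x)).
  rewrite -!mulrDr ler_wpM2l// ler_wpM2l//; first by rewrite exprn_ge0// ltW// jbracket_gt0.
  rewrite -Re_cut -Im_cut -Re_Dpart -Im_Dpart; exact: cabs_le.
exists (K * B) => W w bW w0 Wc Ww.
rewrite -ler_pdivlMl// mulrCA; apply: HK; first exact: schwartz_cut.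
by move=> s x sN; rewrite ler_pdivlMl//; apply: (HB s sN) => //; exact: ltW.
Qed.

End cutoffs.

(** * Unique continuation *)

Section unique_continuation.
Variables (R : realType) (d : nat).
Local Notation Rd := 'rV[R]_d.
Local Notation C := R[i].
Local Notation Re := complex.Re.
Local Notation Im := complex.Im.
Variable f : functional R d.
Hypothesis rf : rapidly_decreasing f.

Lemma vanishes_on_box (V : set Rd) (T : functional R d) (phi : Rd -> C) (c : Rd) (r : R) :
  vanishes_on V T -> smooth phi -> (forall x, phi x != 0 -> `|x - c| <= r) ->
  (forall x, `|x - c| <= r -> V x) -> T phi = 0.
Proof.
move=> vT sphi supp rV.
pose K := [set x : Rd | `|x - c| <= r].
have cK : closed K.
  rewrite (_ : K = (fun x : Rd => `|x - c|) @^-1` [set y | y <= r]); last by [].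
  apply: closed_comp; last exact: closed_le.
  move=> x _; apply: (@continuous_comp _ _ _ (fun x : Rd => x - c) (fun y : Rd => `|y|)).
    by apply: continuousB; [exact: cvg_id|exact: cst_continuous].
  exact: norm_continuous.
have clK : closure [set x | phi x != 0] `<=` K.
  rewrite ((closure_id K).1 cK); apply: closureS => x; exact: supp.
apply: vT => //; last by apply: subset_trans clK _ => x; exact: rV.
apply: bounded_closed_compact; last exact: closed_closure.
exists (`|c| + r); split; first exact: num_real.
move=> M cM x /clK; rewrite /K /= => xr; apply: le_trans (ltW cM).
by rewrite -[x in `|x|](subrK c) addrC (le_trans (ler_normD _ _))// lerD2l.
Qed.

Variables (V : set Rd) (alpha rho : R) (x0 : Rd).
Hypotheses (alpha0 : 0 < alpha) (rho0 : 0 < rho).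
Hypothesis alphaZ : (alpha - d%:R) / 2 \isn't a Num.int.
Hypothesis x0V : forall x, `|x - x0| < rho * 4 -> V x.
Hypotheses (fV : vanishes_on V f) (IV : vanishes_on V (riesz_potential alpha f)).

Lemma translates_eq0 (phi : Rd -> C) : schwartz phi ->
  (forall x, phi x != 0 -> `|x - x0| <= rho) -> forall x, f (fun y => phi (x + y)) = 0.
Proof.
move=> sphi supp.
have suppa a : forall y, phi (a + y) != 0 -> `|y - (x0 - a)| <= rho.
  by move=> y /supp; rewrite opprB addrA addrAC addrC addrA.
(* The support radius rho and a shift below 2 rho add up to less than the 4 rho available around
   x0. *)
have near a : `|a| < rho *+ 2 -> forall y, `|y - (x0 - a)| <= rho -> V y.
  move=> ar y yr; apply: x0V.
  rewrite (_ : y - x0 = (y - (x0 - a)) - a); last by rewrite opprB addrA addrAC addrK.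
  apply: le_lt_trans (ler_normB _ _) _.
  apply: le_lt_trans (lerD yr (ltW ar)) _; rewrite (_ : rho * 4 = rho + rho *+ 2 + rho) ?ltrDl//; ring.
have F0 a : `|a| < rho *+ 2 -> f (fun y => phi (a + y)) = 0.
  move=> ar; apply: (vanishes_on_box fV _ (suppa a) (near a ar)).
  by have [] := schwartz_shift a sphi.
have I0 a : `|a| < rho -> riesz_potential alpha f (fun y => phi (a + y)) = 0.
  move=> ar; apply: (vanishes_on_box IV _ (suppa a)); first by have [] := schwartz_shift a sphi.
  by apply: near; apply: lt_trans ar _; rewrite mulr2n ltrDl.
have [DR DI] := decaying_translates rf sphi.
(* By the definition of [conv], the potential at the translated test function integrates the kernel
   against F(x + a); the kernel being real, the two parts separate. *)
have IE a : riesz_potential alpha f (fun y => phi (a + y)) =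
    Complex (rint (fun x => enorm x `^ (- alpha) * Re (f (fun y => phi ((x + a) + y)))))
            (rint (fun x => enorm x `^ (- alpha) * Im (f (fun y => phi ((x + a) + y))))).
  rewrite /riesz_potential /conv /of_fun /integral_Rd -/(rint (fun x => Re (_ * f (fun y => phi (a + (x + y)))))).
  have E (x : Rd) : (fun y => phi (a + (x + y))) = (fun y => phi ((x + a) + y)).
    by apply/funext => y; rewrite addrA [a + x]addrC.
  congr Complex; rewrite -[LHS]/(rint (fun x => _ ((enorm x `^ (- alpha))%:C%C * f (fun y => phi (a + (x + y))))));
    congr rint; apply/funext => x.
    by rewrite complex_ReM /= mul0r subr0 E.
  by rewrite complex_ImM /= mul0r addr0 E.
move=> x; apply/eqP; rewrite eq_complex /=; apply/andP; split; apply/eqP.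
  apply: (riesz_kernel_eq0 alpha0 rho0 alphaZ DR.1 (decaying_integrable DR)) x.
    by move=> x xr; rewrite F0.
  by move=> a ar; have := I0 a ar; rewrite IE => -[].
apply: (riesz_kernel_eq0 alpha0 rho0 alphaZ DI.1 (decaying_integrable DI)) x.
  by move=> x xr; rewrite F0.
by move=> a ar; have := I0 a ar; rewrite IE => -[].
Qed.

(** Interpolates between supports in a box of half-width rho (k = d) and no constraint at all (k =
    0); the induction frees one coordinate at a time. *)
Definition killed (k : nat) := forall psi : Rd -> C, schwartz psi ->
  (exists c : Rd, forall x, psi x != 0 ->
     forall i : 'I_d, (i < k)%N -> `|x 0 i - c 0 i| <= rho) -> f psi = 0.

(** The translate of psi centred at x0 is admissible in [translates_eq0]; evaluating at x0 - c,
    which may be far from the origin, brings psi back. *)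
Lemma killed_box : killed d.
Proof.
move=> psi spsi [c Hc].
have := @translates_eq0 (fun y => psi ((c - x0) + y)) (schwartz_shift _ spsi) _ (x0 - c).
rewrite (_ : (fun y => psi _) = psi); last first.
  by apply/funext => y; rewrite addrA -opprB addNr add0r.
apply => x /Hc xc; apply: row_norm_le; first exact: ltW.
move=> i; have := xc i (ltn_ord i); rewrite !mxE.
by congr (`|_| <= _); ring.
Qed.

(* T a is the value of f at psi cut off to x_k > - a.  Raising a by rho adds a
   function whose k-th coordinate is confined, so T is rho-periodic and f takes
   the value 0 at psi cut off to |x_k| < A; the rest of psi tends to 0 in the
   Schwartz space as A tends to infinity. *)
Lemma killed_step (k : nat) : (k < d)%N -> killed k.+1 -> killed k.
Proof.
move=> kd Kk psi spsi [c Hc].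
pose i0 := Ordinal kd.
have [U [dU U0 U1 Uout bU]] := smooth_step_exists rho0.
have tU : bounded_tower U by [].
have tUa a := bounded_tower_shift a tU.
pose T a := f (cut i0 (fun t => U 0%N (t + a)) psi).
have [lf _] := rf.1.
have Tstep a : T a = T (a - rho).
  pose D := cut i0 (fun t => U 0%N (t + a) - U 0%N (t + (a - rho))) psi.
  have tD := bounded_towerB (tUa a) (tUa (a - rho)).
  have sD : schwartz D := schwartz_cut i0 tD spsi.
  have D0 : f D = 0.
    (* The two steps differ only for x_k between - a and 2 rho - a, an interval of radius rho
       centred at rho - a. *)
    apply: Kk => //; exists (\row_i if i == i0 then rho - a else c 0 i) => x Dx i ik.
    rewrite mxE; case: eqP => [->|/eqP ii0]; last first.
      apply: Hc; first by apply: contra Dx => /eqP p0; rewrite /D /cut p0 mulr0.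
      move: ik; rewrite ltnS leq_eqVlt => /orP[/eqP ik|//].
      by case/eqP: ii0; exact: val_inj.
    rewrite leNgt; apply: contra Dx; rewrite ltr_normr => /orP[xa|xa].
      have h1 : rho <= x 0 i0 + (a - rho) by rewrite ltW// addrA ltrBrDr; lra.
      have h2 : rho <= x 0 i0 + a by apply: le_trans h1 _; rewrite lerD2l gerBl ltW.
      by rewrite /D /cut U1// U1// subrr mul0r.
    have h1 : x 0 i0 + a <= 0 by lra.
    have h2 : x 0 i0 + (a - rho) <= 0 by apply: le_trans h1; rewrite lerD2l gerBl ltW.
    by rewrite /D /cut U0// U0// subrr mul0r.
  have sa := schwartz_cut i0 (tUa (a - rho)) spsi.
  rewrite /T -[RHS]add0r -[X in X + _]D0 -[f D]mul1r -lf//.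
  congr f; apply/funext => x; rewrite mul1r /D /cut -mulrDl.
  by congr (_ * _); apply/eqP; rewrite eq_complex /= subrK addr0 !eqxx.
have Tn a n : T a = T (a - n%:R * rho).
  elim: n => [|n IH]; first by rewrite mul0r subr0.
  by rewrite IH Tstep; congr T; rewrite -natr1; ring.
have /choice[cU HcU] := bU.
(* These constants bound 1 minus a difference of two translates of U, with all derivatives, whatever
   the translations; so B does not depend on n. *)
have [B HB] := cutoff_decay i0 (fun m => 1 + cU m + cU m) rf.1 spsi.
have small n : n.+1%:R * rho * cabs (f psi) <= B.
  (* One rho more than the weight (n+1) rho: for |t| < (n+1) rho the step at t + A has already
     reached 1 and the one at t - A is still 0, so the remainder vanishes there. *)
  pose A := n.+2%:R * rho.
  have tE := bounded_towerB (tUa A) (tUa (- A)).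
  have tW := bounded_towerB (bounded_tower1 R) tE.
  have sE := schwartz_cut i0 tE spsi.
  have sW := schwartz_cut i0 tW spsi.
  have TA : T A = T (- A).
    (* From A to - A there are 2(n+2) steps of length rho. *)
    rewrite (Tn A (n.+2 + n.+2)%N); congr T; rewrite natrD /A; ring.
  have fE : f (cut i0 (fun t => U 0%N (t + A) - U 0%N (t + - A)) psi) = 0.
    have sA := schwartz_cut i0 (tUa (- A)) spsi.
    have := lf 1 _ _ sE sA; rewrite mul1r -/(T (- A)) -TA => H.
    apply: (addIr (T A)); rewrite add0r -H; congr f; apply/funext => x.
    rewrite mul1r /cut -mulrDl; congr (_ * _).
    by apply/eqP; rewrite eq_complex /= subrK addr0 !eqxx.
  have -> : f psi = f (cut i0 (fun t => (0%N == 0%N)%:R - (U 0%N (t + A) - U 0%N (t + - A))) psi).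
    rewrite -[RHS]add0r -fE -[X in X + _]mul1r -lf//; congr f; apply/funext => x.
    rewrite mul1r /cut -mulrDl -[LHS]mul1r; congr (_ * _).
    by apply/eqP; rewrite eq_complex /= subrKC addr0 !eqxx.
  apply: (HB _ _ tW).
  - by rewrite mulr_gt0.
  - move=> m t; apply: le_trans (ler_normB _ _) _; rewrite -addrA lerD//.
      by case: m => [|m] /=; rewrite ?normr1 ?normr0.
    by apply: le_trans (ler_normB _ _) _; rewrite lerD.
  - move=> m t; rewrite ltr_norml => /andP[t1 t2].
    have h1 : rho < t + A.
      by rewrite /A -natr1 mulrDl mul1r addrA ltrDr -ltrBlDr sub0r.
    have h2 : t + - A < 0.
      by rewrite subr_lt0 /A -natr1 mulrDl mul1r (lt_trans t2)// ltrDl.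
    case: m => [|m] /=; first by rewrite U1 ?ltW// U0 ?ltW// subr0 subrr.
    by rewrite Uout ?Uout ?subrr//; [left|right].
apply: cabs_eq0; rewrite leNgt; apply/negP => f0.
have := small (Num.truncn (B / (rho * cabs (f psi)))).
have rf0 : 0 < rho * cabs (f psi) by rewrite mulr_gt0.
have := truncnS_gt (B / (rho * cabs (f psi))).
rewrite ltr_pdivrMr// -mulrA => h1 /(lt_le_trans h1).
by rewrite ltxx.
Qed.

Lemma killed_all : killed 0.
Proof.
suff H n : (n <= d)%N -> killed (d - n) by rewrite -(subnn d); exact: H.
elim: n => [_|n IH nd]; first by rewrite subn0; exact: killed_box.
by apply: killed_step; [rewrite subnSK// leq_subr|rewrite subnSK//; exact: IH (ltnW nd)].
Qed.

End unique_continuation.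

Theorem theorem5p2 (R : realType) (d : nat) (hd : (2 <= d)%N)
    (f : functional R d) (hf : rapidly_decreasing f)
    (V : set 'rV[R]_d) (oV : open V) (V0 : V !=set0)
    (alpha : R) (ha0 : 0 < alpha) (had : alpha < d%:R)
    (haZ : (alpha - d%:R) / 2 \isn't a Num.int)
    (hfV : vanishes_on V f)
    (hIV : vanishes_on V (riesz_potential alpha f)) :
  distr_eq f (@distr0 R d).
Proof.
move: V0 => [x0 Vx0].
have /nbhs_ballP[e /= e0 eV] : nbhs x0 V by exact: open_nbhs_nbhs.
(* A quarter of the radius, since a ball of radius 4 rho around x0 must lie in V. *)
have r0 : 0 < e / 4 by rewrite divr_gt0.
move=> psi spsi.
apply: (@killed_all R d f hf V alpha (e / 4) x0) => //; last by exists 0.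
by move=> x; rewrite divfK// => xe; apply: eV; rewrite -ball_normE /= distrC.
Qed.
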